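(* Let $u\subseteq\{1,\dots,d\}$ with $u\neq\varnothing$, $u\neq\{1,\dots,d\}$, let $g$ be an auxiliary probability density on $\mathbb{X}$ such that $g(\mathbf{x})>0$ whenever $\psi_t(\mathbf{x})f_{\mathbf{X}}(\mathbf{x})>0$, and let $N\ge 2$, $N_u\ge 1$ be integers. Then the estimator $\widehat{\text{T-VE}}_{u,\text{PF}}^{\text{IS}}$ defined in the context is an unbiased estimator of $\text{T-VE}_u=\mathbb{V}_{f_{\mathbf{X}}}\left[\mathbb{E}_{f_{\mathbf{X}}}\left(\psi_t(\mathbf{X})\,|\,\mathbf{X}_u\right)\right]$, i.e. $$\mathbb{E}_g\left[\widehat{\text{T-VE}}_{u,\text{PF}}^{\text{IS}}\right]=\text{T-VE}_u,$$ and it requires $2N_u$ evaluations of the function $\phi$ in addition to those used in $\widehat{p}_{t,N}^{\text{IS},\text{ub}}$ to estimate $p_t^2$.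
   Context: $\mathbb{X}=\mathbb{X}_1\times\dots\times\mathbb{X}_d\subseteq\mathbb{R}^d$; $\mathbf{X}=(X_1,\dots,X_d)$ is a random vector in $\mathbb{X}$ with joint density $f_{\mathbf{X}}$ (components possibly dependent); $\phi:\mathbb{X}\to\mathbb{R}$ is a measurable function, $t\in\mathbb{R}$, $\psi_t(\mathbf{x})=\mathbf{1}(\phi(\mathbf{x})>t)$ and $p_t=\mathbb{P}(\phi(\mathbf{X})>t)$. For $u\subseteq\{1,\dots,d\}$, $-u=\{1,\dots,d\}\setminus u$, $\mathbf{X}_u=(X_i)_{i\in u}$, and $(\mathbf{x}_u,\mathbf{x}_{-u})$ denotes the vector of $\mathbb{X}$ with these sub-vectors. $f_{\mathbf{X}_u}$ and $g_{\mathbf{X}_u}$ are the marginal densities on the coordinates $u$ of $f_{\mathbf{X}}$ and $g$; $g_{\mathbf{X}_{-u}|\mathbf{X}_u=\mathbf{x}_u}$ is the conditional density under $g$. $\mathbb{E}_h,\mathbb{V}_h$ denote expectation and variance when the underlying vector has density $h$ (for estimators under $g$: when the samples are drawn from $g$ as described below). Define $w_t^g(\mathbf{x})=\psi_t(\mathbf{x})f_{\mathbf{X}}(\mathbf{x})/g(\mathbf{x})$. The convention $0/0=0$ is used; in particular any term involving a factor $w_t^g(\mathbf{x}_u,\mathbf{x}_{-u})$ with $f_{\mathbf{X}_u}(\mathbf{x}_u)=0$ is set to $0$, even when it is divided by $f_{\mathbf{X}_u}(\mathbf{x}_u)$. Samples: $(\mathbf{X}_u^{(n)})_{1\le n\le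 N_u}$ is i.i.d. with density $g_{\mathbf{X}_u}$; for each $n$, conditionally on $\mathbf{X}_u^{(n)}$, $\mathbf{X}_{-u}^{(n,1)},\mathbf{X}_{-u}^{(n,2)}$ are independent with density $g_{\mathbf{X}_{-u}|\mathbf{X}_u=\mathbf{X}_u^{(n)}}$. With $(\mathbf{X}^{(n)})_{1\le n\le N}$ i.i.d. with density $g$, let $\widehat{p}_{t,N}^{\text{IS}}=\frac1N\sum_{n=1}^N w_t^g(\mathbf{X}^{(n)})$ and $$\widehat{p}_{t,N}^{\text{IS},\text{ub}}=\left(\widehat{p}_{t,N}^{\text{IS}}\right)^2-\frac1{N-1}\left[\frac1N\sum_{n=1}^N w_t^g(\mathbf{X}^{(n)})^2-\left(\widehat{p}_{t,N}^{\text{IS}}\right)^2\right].$$ Estimator: $$\widehat{\text{T-VE}}_{u,\text{PF}}^{\text{IS}}=\frac1{N_u}\sum_{n=1}^{N_u}w_t^g\left(\mathbf{X}_u^{(n)},\mathbf{X}_{-u}^{(n,1)}\right)w_t^g\left(\mathbf{X}_u^{(n)},\mathbf{X}_{-u}^{(n,2)}\right)\frac{g_{\mathbf{X}_u}(\mathbf{X}_u^{(n)})}{f_{\mathbf{X}_u}(\mathbf{X}_u^{(n)})}-\widehat{p}_{t,N}^{\text{IS},\text{ub}}.$$ *)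

(* Defs.v *)
From HB Require Import structures.
From mathcomp Require Import all_boot all_order all_algebra.
From mathcomp Require Import all_classical all_reals all_analysis.

Set Implicit Arguments.
Unset Strict Implicit.
Unset Printing Implicit Defensive.

Import Order.TTheory GRing.Theory Num.Theory.
Import numFieldNormedType.Exports.

Local Open Scope classical_set_scope.
Local Open Scope ring_scope.

Section cons_measure.
Context {R : realType} {n : nat}.
Variable mu : {sigma_finite_measure set (n.-tuple R) -> \bar R}.

(** The codomain carries the Borel structure of [R], whose display differs from
    that of [measurableTypeR R], the domain of [lebesgue_measure]. *)
Definition cons_tuple (p : measurableTypeR R * n.-tuple R) : n.+1.-tuple R :=
  [tuple of (p.1 : R) :: p.2].

Lemma measurable_cons_tuple :
  measurable_fun [set: (measurableTypeR R * n.-tuple R)%type] cons_tuple.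
Proof.
apply: (@measurable_cons _ _ _ R (fun p => p.1 : R)); last first.
  exact: measurable_snd.
move=> _ Y mY; exact: (@measurable_fst _ _ (measurableTypeR R) (n.-tuple R)).
Qed.

Definition cons_measure : set (n.+1.-tuple R) -> \bar R :=
  pushforward (lebesgue_measure \x mu)%E cons_tuple.

Let prod_mu : {measure set (measurableTypeR R * n.-tuple R)%type -> \bar R} :=
  (lebesgue_measure \x mu)%E.

Let cons_measure_measure : {measure set (n.+1.-tuple R) -> \bar R} :=
  measure_function_pushforward__canonical__measure_function_Measure
    prod_mu measurable_cons_tuple.

Let cons_measure0 : cons_measure set0 = 0%E.
Proof. exact: (measure0 cons_measure_measure). Qed.

Let cons_measure_ge0 A : (0 <= cons_measure A)%E.
Proof. exact: (measure_ge0 cons_measure_measure). Qed.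

Let cons_measure_sigma_additive : semi_sigma_additive cons_measure.
Proof. exact: (@measure_semi_sigma_additive _ _ _ cons_measure_measure). Qed.

HB.instance Definition _ := isMeasure.Build _ _ _ cons_measure
  cons_measure0 cons_measure_ge0 cons_measure_sigma_additive.

Let uncons (t : n.+1.-tuple R) : measurableTypeR R * n.-tuple R :=
  (thead t, [tuple of behead t]).

Let measurable_uncons : measurable_fun [set: n.+1.-tuple R] uncons.
Proof.
apply/measurable_fun_pair => /=; last exact: measurable_behead.
exact: (@measurable_tnth _ R n.+1 ord0).
Qed.

Let cons_measure_sigma_finite : sigma_finite [set: n.+1.-tuple R] cons_measure.
Proof.
have /sigma_finiteP[F [TF ndF Foo]] := sigma_finiteT (@lebesgue_measure R).
have /sigma_finiteP[G [TG ndG Goo]] := sigma_finiteT mu.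
exists (fun k => uncons @^-1` (F k `*` G k)).
  rewrite predeqE => t; split=> // _.
  have [k _ Fk] : (\bigcup_k F k) (thead t) by rewrite -TF.
  have [l _ Gl] : (\bigcup_k G k) [tuple of behead t] by rewrite -TG.
  exists (maxn k l) => //; split => /=.
    by move: (thead t) Fk; exact/subsetPset/ndF/leq_maxl.
  by move: [tuple of behead t] Gl; exact/subsetPset/ndG/leq_maxr.
move=> k; have [mF Fkoo] := Foo k; have [mG Gkoo] := Goo k; split.
  by rewrite -[X in measurable X]setTI; apply: measurable_uncons => //;
    exact: measurableX.
rewrite /cons_measure /pushforward -comp_preimage.
rewrite (_ : uncons \o cons_tuple = id); last first.
  rewrite funeqE => -[x y] /=.
  by rewrite /uncons /cons_tuple/= theadE; congr pair; exact/val_inj.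
by rewrite preimage_id product_measure1E// lte_mul_pinfty// ge0_fin_numE.
Qed.

HB.instance Definition _ := Measure_isSigmaFinite.Build _ _ _ cons_measure
  cons_measure_sigma_finite.

End cons_measure.

Fixpoint lebesgue_tuple {R : realType} (n : nat) :
    {sigma_finite_measure set (n.-tuple R) -> \bar R} :=
  match n with
  | 0 => [the {sigma_finite_measure set _ -> \bar R} of \d_([tuple] : 0.-tuple R)]
  | n'.+1 =>
    [the {sigma_finite_measure set _ -> \bar R} of cons_measure (lebesgue_tuple n')]
  end.

Lemma lebesgue_tuple_box (R : realType) (n : nat) (A : 'I_n -> set R) :
  (forall i, measurable (A i)) ->
  lebesgue_tuple n [set t : n.-tuple R | forall i, A i (tnth t i)] =
  (\prod_(i < n) lebesgue_measure (A i))%E.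
Proof.
elim: n A => [|n IH] A mA.
  by rewrite big_ord0 /= diracE mem_set// => -[].
rewrite big_ord_recl /= /cons_measure /pushforward.
rewrite (_ : _ @^-1` _ = A ord0 `*`
    [set t : n.-tuple R | forall i, A (lift ord0 i) (tnth t i)]); last first.
  apply/seteqP; split => -[x y] /=.
    move=> H; split; first exact: (H ord0).
    by move=> i; have := H (lift ord0 i); rewrite /cons_tuple/= tnthS.
  move=> [Hx Hy] i; case: (unliftP ord0 i) => [j ->|->//].
  by rewrite /cons_tuple tnthS; exact: Hy.
have mB : measurable
    [set t : n.-tuple R | forall i, A (lift ord0 i) (tnth t i)].
  rewrite (_ : [set t | _] = \bigcap_(i in [set: 'I_n])
      ((fun t : n.-tuple R => tnth t i) @^-1` A (lift ord0 i))); last first.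
    by apply/seteqP; split => t /= H i => [_|]; exact: H.
  apply: fin_bigcap_measurable => [|i _]; first exact: finite_finset.
  by rewrite -[X in measurable X]setTI; exact: measurable_tnth.
rewrite product_measure1E//; last exact: (mA ord0).
by congr (_ * _)%E; exact: IH.
Qed.

Definition mutually_independent {R : realType} {dO} {O : measurableType dO}
    (P : probability O R) {dT} {T : measurableType dT} {I : finType}
    (X : I -> {RV P >-> T}) : Prop :=
  forall (J : {set I}) (A : I -> set T), (forall i, measurable (A i)) ->
    P (\bigcap_(i in [set` J]) (X i @^-1` A i)) =
    (\prod_(i in J) P (X i @^-1` A i))%E.

Definition has_density {R : realType} {dO} {O : measurableType dO}
    (P : probability O R) {n : nat} (X : {RV P >-> n.-tuple R})
    (h : n.-tuple R -> R) : Prop :=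
  forall A : set (n.-tuple R), measurable A ->
    P (X @^-1` A) = (\int[lebesgue_tuple n]_(x in A) (h x)%:E)%E.

Definition iid_with_density {R : realType} {dO} {O : measurableType dO}
    (P : probability O R) {n : nat} {I : finType}
    (X : I -> {RV P >-> n.-tuple R}) (h : n.-tuple R -> R) : Prop :=
  mutually_independent X /\ forall i, has_density (X i) h.

Section conditioning.
Context {R : realType} {dO} {O : measurableType dO} (P : probability O R).
Context {dT} {T : measurableType dT}.
Implicit Types (X : O -> T) (Y Z : O -> R).
Local Open Scope ereal_scope.

(** [Z] is a version of [E(Y | X)]; [preimage_set_system setT X measurable] is
    the sigma-algebra generated by [X]. *)
Definition is_cond_exp X Y Z : Prop :=
  [/\ forall B : set R, measurable B ->
        preimage_set_system setT X measurable (Z @^-1` B),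
      P.-integrable setT (EFin \o Z) &
      forall E, preimage_set_system setT X measurable E ->
        \int[P]_(w in E) (Z w)%:E = \int[P]_(w in E) (Y w)%:E].

(** A chosen version of [E(Y | X)]; two versions agree almost surely. *)
Definition cond_exp X Y : O -> R :=
  xget (fun=> 0%R) [set Z | is_cond_exp X Y Z].

(** Conditionally on [X], the vector [Y] has density [h (X w)]. *)
Definition has_cond_density X {n : nat} (Y : O -> n.-tuple R)
    (h : T -> n.-tuple R -> R) : Prop :=
  forall B : set (n.-tuple R), measurable B ->
    is_cond_exp X (\1_(Y @^-1` B))
      (fun w => (\int[lebesgue_tuple n]_(y in B) h (X w) y)%R).

Definition cond_independent X {dU} {U : measurableType dU} (Y1 Y2 : O -> U) :
    Prop :=
  forall B C : set U, measurable B -> measurable C ->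
  forall Z1 Z2 : O -> R,
    is_cond_exp X (\1_(Y1 @^-1` B)) Z1 ->
    is_cond_exp X (\1_(Y2 @^-1` C)) Z2 ->
    is_cond_exp X (\1_(Y1 @^-1` B `&` Y2 @^-1` C)) (Z1 \* Z2)%R.

End conditioning.

Section subvectors.
Context {R : realType} {d : nat}.
Implicit Types (u : {set 'I_d}) (h : d.-tuple R -> R).

Definition domain (D : 'I_d -> set R) : set (d.-tuple R) :=
  [set x | forall i, D i (tnth x i)].

(** Densities on the domain are extended by [0] to the whole space. *)
Definition is_density (D : 'I_d -> set R) h : Prop :=
  [/\ measurable_fun setT h, forall x, 0 <= h x,
      forall x, ~ domain D x -> h x = 0 &
      (\int[lebesgue_tuple d]_x (h x)%:E = 1)%E].

(** The coordinates of sub-vectors are listed in the order of [enum u]. *)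
Definition subvec u (x : d.-tuple R) : #|u|.-tuple R :=
  [tuple tnth x (enum_val j) | j < #|u|].

Definition merge u (xu : #|u|.-tuple R) (xv : #|~: u|.-tuple R) : d.-tuple R :=
  [tuple if i \in u then nth 0 xu (index i (enum u))
         else nth 0 xv (index i (enum (~: u))) | i < d].

(** The integral is [fine]d: the marginal of a density is infinite at most on a
    Lebesgue-null set of [xu], where it is given the value [0]. *)
Definition marginal u h (xu : #|u|.-tuple R) : R :=
  \int[lebesgue_tuple #|~: u|]_y h (merge xu y).

Definition cond_density u h (xu : #|u|.-tuple R) (y : #|~: u|.-tuple R) : R :=
  h (merge xu y) / marginal h xu.

Lemma subvec_merge u (xu : #|u|.-tuple R) (xv : #|~: u|.-tuple R) :
  subvec u (merge xu xv) = xu /\ subvec (~: u) (merge xu xv) = xv.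
Proof.
split; apply: eq_from_tnth => j; rewrite !tnth_mktuple.
  have ju := enum_valP j; rewrite ju (tnth_nth 0) /enum_val.
  by rewrite index_uniq ?enum_uniq// -cardE.
have := enum_valP j; rewrite inE => /negbTE ->.
rewrite (tnth_nth 0) /enum_val.
by rewrite index_uniq ?enum_uniq// -cardE.
Qed.

End subvectors.

Section estimators.
Context {R : realType} {d : nat}.
Variables (D : 'I_d -> set R) (f g : d.-tuple R -> R) (t : R).
Implicit Types (phi : d.-tuple R -> R) (x : d.-tuple R) (u : {set 'I_d}).

(** Only the values of [phi] on the domain matter. *)
Definition psi phi x : R := \1_[set z | domain D z /\ t < phi z] x.

(** As [0^-1 = 0], the convention [0/0 = 0] holds, also for the quotient
    [marginal g _ / marginal f _] below. *)
Definition weight phi x : R := psi phi x * f x / g x.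

Definition p_IS phi (N : nat) (x : 'I_N -> d.-tuple R) : R :=
  N%:R^-1 * \sum_(n < N) weight phi (x n).

Definition p_IS_ub phi (N : nat) (x : 'I_N -> d.-tuple R) : R :=
  p_IS phi x ^+ 2 -
  (N%:R - 1)^-1 * (N%:R^-1 * (\sum_(n < N) weight phi (x n) ^+ 2)
                   - p_IS phi x ^+ 2).

Definition TVE_PF_IS phi u (Nu : nat) (xu : 'I_Nu -> #|u|.-tuple R)
    (y1 y2 : 'I_Nu -> #|~: u|.-tuple R) (N : nat) (x : 'I_N -> d.-tuple R) : R :=
  Nu%:R^-1 * (\sum_(n < Nu)
    weight phi (merge (xu n) (y1 n)) * weight phi (merge (xu n) (y2 n)) *
    (marginal g (xu n) / marginal f (xu n)))
  - p_IS_ub phi x.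

Definition TVE phi u {dO} {O : measurableType dO} (P : probability O R)
    (X : O -> d.-tuple R) : \bar R :=
  ('V_P[cond_exp P (subvec u \o X) (psi phi \o X)])%E.

End estimators.

(** Programs computing an [A], whose only access to the black-box function
    [T -> V] is through explicit evaluations. *)
Inductive program (T V A : Type) : Type :=
| Return of A
| Evaluate of T & (V -> program T V A).
Arguments Return {T V A}.

Section programs.
Context {T V : Type}.

Fixpoint run {A} (phi : T -> V) (p : program T V A) : A :=
  match p with
  | Return a => a
  | Evaluate x k => run phi (k (phi x))
  end.

Fixpoint nb_evals {A} (phi : T -> V) (p : program T V A) : nat :=
  match p with
  | Return _ => 0
  | Evaluate x k => (nb_evals phi (k (phi x))).+1
  end.

Fixpoint bind {A B} (p : program T V A) (q : A -> program T V B) :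
    program T V B :=
  match p with
  | Return a => q a
  | Evaluate x k => Evaluate x (fun v => bind (k v) q)
  end.

Fixpoint sum_prog {I : Type} {A : nmodType} (s : seq I)
    (p : I -> program T V A) : program T V A :=
  if s is i :: s' then
    bind (p i) (fun a => bind (sum_prog s' p) (fun b => Return (a + b)))
  else Return 0.

End programs.

Section estimation_programs.
Context {R : realType} {d : nat}.
Variables (D : 'I_d -> set R) (f g : d.-tuple R -> R) (t : R).
Local Notation prog := (program (d.-tuple R) R).

Definition weight_prog (x : d.-tuple R) : prog R :=
  Evaluate x (fun v => Return (weight D f g t (fun=> v) x)).

Definition p_IS_ub_prog (N : nat) (x : 'I_N -> d.-tuple R) : prog R :=
  bind (sum_prog (enum 'I_N) (fun n =>
          bind (weight_prog (x n)) (fun w => Return (w, w ^+ 2))))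
    (fun s => let p := N%:R^-1 * s.1 in
      Return (p ^+ 2 - (N%:R - 1)^-1 * (N%:R^-1 * s.2 - p ^+ 2))).

Definition TVE_PF_IS_prog (u : {set 'I_d}) (Nu : nat)
    (xu : 'I_Nu -> #|u|.-tuple R) (y1 y2 : 'I_Nu -> #|~: u|.-tuple R)
    (N : nat) (x : 'I_N -> d.-tuple R) : prog R :=
  bind (sum_prog (enum 'I_Nu) (fun n =>
          bind (weight_prog (merge (xu n) (y1 n))) (fun w1 =>
          bind (weight_prog (merge (xu n) (y2 n))) (fun w2 =>
          Return (w1 * w2 * (marginal g (xu n) / marginal f (xu n)))))))
    (fun s => bind (p_IS_ub_prog x) (fun p => Return (Nu%:R^-1 * s - p))).

End estimation_programs.

(* Main.v *)
(** Write [b] for the indicator [psi], [s(x_u)] for the integral of [b f] over the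
    coordinates outside [u], and [p] for the integral of [b f]. The weight satisfies
    [w g = b f], so integrating [w(x_u, y)] against the conditional density
    [g(x_u, .) / g_u(x_u)] gives [s / g_u]. By conditional independence each
    pick-freeze term therefore has mean the integral of
    [g_u * (g_u / f_u) * (s / g_u)^2 = s^2 / f_u], which is also the second moment of
    [s / f_u] under [f_u], that is, of the conditional expectation of [psi].
    The squares cancel in [p_IS_ub], which equals the average of [w_i w_j] over
    [i <> j]: its mean is [p^2] by pairwise independence, and no second moment of the
    weight needs to be finite. Only equalities that hold almost everywhere are
    available, since marginals may be infinite on a null set. *)

Require Import Defs.
From HB Require Import structures.
From mathcomp Require Import all_boot all_order all_algebra.
From mathcomp Require Import all_classical all_reals all_analysis.
From mathcomp Require Import measurable_realfun ring.

Set Implicit Arguments.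
Unset Strict Implicit.
Unset Printing Implicit Defensive.

Import Order.TTheory GRing.Theory Num.Theory.
Import numFieldNormedType.Exports.

Local Open Scope classical_set_scope.
Local Open Scope ring_scope.

(** After the imports, [merge] alone denotes the merging of sorted lists. *)
Local Notation merge := Defs.merge.

(** * Measures with densities and products *)

Section density.
Local Open Scope ereal_scope.
Context {d} {T : measurableType d} {R : realType}.
Variables (m : {measure set T -> \bar R}) (k : T -> R).

(** The proofs [mk] and [k0] are arguments so that the measure structure, which depends on them, can
    be inferred from the term [mdensity mk k0]. *)
Definition mdensity (mk : measurable_fun setT k) (k0 : forall x, (0 <= k x)%R)
    (A : set T) : \bar R := \int[m]_(x in A) (k x)%:E.

Hypotheses (mk : measurable_fun setT k) (k0 : forall x, (0 <= k x)%R).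

Let mdensity0 : mdensity mk k0 set0 = 0.
Proof. exact: integral_set0. Qed.

Let mdensity_ge0 A : 0 <= mdensity mk k0 A.
Proof. by apply: integral_ge0 => x _; rewrite lee_fin. Qed.

Let mdensity_sigma_additive : semi_sigma_additive (mdensity mk k0).
Proof.
move=> F mF tF mUF; rewrite /mdensity ge0_integral_bigcup//; last 2 first.
- exact/measurable_EFinP/measurable_funTS.
- by move=> x _; rewrite lee_fin.
apply: is_cvg_ereal_nneg_natsum_cond => n _ _.
by apply: integral_ge0 => x _; rewrite lee_fin.
Qed.

HB.instance Definition _ := isMeasure.Build _ _ _ (mdensity mk k0)
  mdensity0 mdensity_ge0 mdensity_sigma_additive.

Import HBNNSimple.

(** Monotone limits of simple functions reduce the identity to indicators, where it is the
    hypothesis on [nu]. *)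
Lemma ge0_integral_density (nu : {measure set T -> \bar R}) (F : T -> \bar R) :
    (forall A, measurable A -> nu A = \int[m]_(x in A) (k x)%:E) ->
    measurable_fun setT F -> (forall x, 0 <= F x) ->
  \int[nu]_x F x = \int[m]_x (F x * (k x)%:E).
Proof.
move=> nuE mF F0; pose F_ := nnsfun_approx measurableT mF.
have mkE : measurable_fun setT (EFin \o k) by exact/measurable_EFinP.
transitivity (limn (fun n => \int[nu]_x (F_ n x)%:E)).
  rewrite -monotone_convergence//.
  - by apply: eq_integral => x _; apply/esym/cvg_lim => //; exact: cvg_nnsfun_approx.
  - by move=> n; exact/measurable_EFinP.
  - by move=> n x _; rewrite lee_fin.
  - by move=> x _ a b ab; rewrite lee_fin; exact/lefP/nd_nnsfun_approx.
rewrite [X in limn X](_ : _ =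
    (fun n => \int[m]_x ((F_ n x)%:E * (k x)%:E))); last first.
  apply/funext => n.
  under eq_integral do rewrite fimfunE -fsumEFin//.
  rewrite ge0_integral_fsum//; last 2 first.
  - by move=> r; exact/measurable_EFinP/measurable_funM.
  - by move=> r x _; rewrite nnfun_muleindic_ge0.
  under [in RHS]eq_integral => x _.
    rewrite fimfunE -fsumEFin// ge0_mule_fsuml; last first.
      by move=> r; rewrite nnfun_muleindic_ge0.
    over.
  rewrite ge0_integral_fsum//; last 2 first.
  - by move=> r; apply: emeasurable_funM => //; exact/measurable_EFinP/measurable_funM.
  - by move=> r x _; rewrite mule_ge0 ?nnfun_muleindic_ge0 ?lee_fin.
  apply: eq_fsbigr => r; rewrite inE => -[x _ <-].
  rewrite integralZl_indic_nnsfun// integral_indic// setIT nuE//.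
  under [RHS]eq_integral do rewrite EFinM -muleA.
  rewrite ge0_integralZl//; last 3 first.
  - by apply: emeasurable_funM => //; exact/measurable_EFinP.
  - by move=> y _; rewrite mule_ge0 ?lee_fin.
  - by rewrite lee_fin.
  congr (_ * _); rewrite [LHS]integral_mkcond; apply: eq_integral => y _.
  by rewrite patchE indicE; case: ifPn; rewrite ?mul1e ?mul0e.
rewrite -monotone_convergence//.
- apply: eq_integral => x _; apply/cvg_lim => //.
  by apply: cvgeZr => //; exact: cvg_nnsfun_approx.
- by move=> n; apply: emeasurable_funM => //; exact/measurable_EFinP.
- by move=> n x _; rewrite mule_ge0 ?lee_fin.
- move=> x _ a b ab; rewrite lee_pmul ?lee_fin//.
  exact/lefP/nd_nnsfun_approx.
Qed.

End density.

(** Rectangles form a pi-system that generates the product sigma-algebra and contains the whole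
    space, so the exhausting sequence can be constant. *)
Lemma eq_measure_rectangle {d1 d2} {T1 : measurableType d1}
    {T2 : measurableType d2} {R : realType}
    (m1 m2 : {measure set (T1 * T2)%type -> \bar R}) :
    (m1 setT < +oo)%E ->
    (forall A B, measurable A -> measurable B -> m1 (A `*` B) = m2 (A `*` B)) ->
  forall E, measurable E -> m1 E = m2 E.
Proof.
move=> m1oo m12 E mE.
apply: (measure_unique
  [set C | exists2 A, measurable A & exists2 B, measurable B & A `*` B = C]
  (fun=> setT)) => //.
- exact: measurable_prod_measurableType.
- move=> _ _ [A mA [B mB <-]] [A' mA' [B' mB' <-]].
  exists (A `&` A'); first exact: measurableI.
  by exists (B `&` B'); [exact: measurableI|rewrite setXI].
- by move=> _; exists setT => //; exists setT => //; rewrite setXTT.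
- by rewrite bigcup_const.
- by move=> _ [A mA [B mB <-]]; exact: m12.
Qed.

(** The two-factor case is used twice: once with the last two factors grouped, once for the finite
    measures that [m1] and [m2] induce on these factors by restriction to [A] in the first one and
    projection. *)
Lemma eq_measure_rectangle3 {d1 d2 d3} {T1 : measurableType d1}
    {T2 : measurableType d2} {T3 : measurableType d3} {R : realType}
    (m1 m2 : {measure set (T1 * (T2 * T3))%type -> \bar R}) :
    (m1 setT < +oo)%E ->
    (forall A B C, measurable A -> measurable B -> measurable C ->
      m1 (A `*` (B `*` C)) = m2 (A `*` (B `*` C))) ->
  forall E, measurable E -> m1 E = m2 E.
Proof.
move=> m1oo m12; apply: eq_measure_rectangle => // A E mA mE.
have mAT : measurable (A `*` [set: T2 * T3]) by exact: measurableX.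
have slice (m : {measure set (T1 * (T2 * T3))%type -> \bar R}) F :
    pushforward (mrestr m mAT) snd F = m (A `*` F).
  rewrite /pushforward /mrestr; congr (m _).
  by apply/seteqP; split => -[x y] /= [] => [? []|? ?]; split.
have msnd : measurable_fun setT (@snd T1 (T2 * T3)%type) by [].
pose nu (m : {measure set (T1 * (T2 * T3))%type -> \bar R}) :
    {measure set (T2 * T3)%type -> \bar R} :=
  measure_function_pushforward__canonical__measure_function_Measure
  (mrestr m mAT) msnd.
have nuE (m : {measure set (T1 * (T2 * T3))%type -> \bar R}) F :
  nu m F = m (A `*` F) by exact: slice.
rewrite -!nuE; apply: eq_measure_rectangle => // [|B C mB mC].
  rewrite nuE (le_lt_trans _ m1oo)//.
  by apply: le_measure; rewrite ?inE//; exact: measurableX.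
by rewrite !nuE m12.
Qed.

(** * Splitting Lebesgue measure along a set of coordinates *)

Section boxes.
Context {R : realType} {n : nat}.
Implicit Types A : 'I_n -> set R.

Lemma measurable_box A : (forall i, measurable (A i)) ->
  measurable [set t : n.-tuple R | forall i, A i (tnth t i)].
Proof.
move=> mA; rewrite (_ : [set t | _] = \bigcap_(i in [set: 'I_n])
    ((fun t : n.-tuple R => tnth t i) @^-1` A i)); last first.
  by apply/seteqP; split => t /= H i => [_|]; exact: H.
apply: fin_bigcap_measurable => [|i _]; first exact: finite_finset.
by rewrite -[X in measurable X]setTI; exact: measurable_tnth.
Qed.

Definition boxes : set (set (n.-tuple R)) :=
  [set B | exists2 A, (forall i, measurable (A i)) &
    B = [set t | forall i, A i (tnth t i)]].

(** A cylinder over one coordinate is a box whose other sides are full, so the boxes generate the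
    sigma-algebra of the coordinate maps. *)
Lemma measurable_tuple_boxes : @measurable _ (n.-tuple R) = <<s boxes >>.
Proof.
apply/seteqP; split; last first.
  apply: smallest_sub; first exact: sigma_algebra_measurable.
  by move=> _ [A mA ->]; exact: measurable_box.
apply: smallest_sub; first exact: smallest_sigma_algebra.
rewrite -bigcup_seq; apply: bigcup_sub => i _ _ [B mB <-].
apply: sub_sigma_algebra; exists (fun j => if j == i then B else setT).
  by move=> j; case: ifP.
apply/seteqP; split => [t /= [_ Bt] j|t /= /(_ i)].
  by case: eqP => // ->.
by rewrite eqxx; split.
Qed.

Lemma setI_closed_boxes : setI_closed boxes.
Proof.
move=> _ _ [A mA ->] [B mB ->]; exists (fun i => A i `&` B i).
  by move=> i; exact: measurableI.
by apply/seteqP; split => t /= => [[At Bt] i|ABt]; [|split => i; have [] := ABt i].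
Qed.

Lemma bigcup_box_itv :
  \bigcup_k [set t : n.-tuple R |
    forall i, `[(- k%:R), k%:R]%classic (tnth t i)] = setT.
Proof.
apply/seteqP; split => // t _.
(* The sum of absolute values dominates every coordinate, so one integer above it bounds them
   all. *)
pose M := \sum_(i < n) `|tnth t i|.
exists (Num.bound M) => // i /=.
rewrite in_itv/= -ler_norml.
have /ltW : M < (Num.bound M)%:R.
  by apply: le_lt_trans (archi_boundP _); [|exact: sumr_ge0].
by apply: le_trans; rewrite /M (bigD1 i)//= lerDl sumr_ge0.
Qed.

End boxes.

Section merge.
Context {R : realType} {d : nat}.
Variable u : {set 'I_d}.

Local Notation leb := lebesgue_tuple.

Lemma tnth_merge_enum (x : #|u|.-tuple R) (y : #|~: u|.-tuple R) j :
  tnth (merge x y) (enum_val j) = tnth x j.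
Proof.
by have [/(congr1 (@tnth _ _ ^~ j)) + _] := subvec_merge x y; rewrite tnth_mktuple.
Qed.

Lemma tnth_merge_enumC (x : #|u|.-tuple R) (y : #|~: u|.-tuple R) j :
  tnth (merge x y) (enum_val j) = tnth y j.
Proof.
by have [_ /(congr1 (@tnth _ _ ^~ j))] := subvec_merge x y; rewrite tnth_mktuple.
Qed.

Lemma enum_val_split (i : 'I_d) :
  (exists j : 'I_#|u|, i = enum_val j) \/ (exists j : 'I_#|~: u|, i = enum_val j).
Proof.
have [iu|iu] := boolP (i \in u).
  by left; exists (enum_rank_in iu i); rewrite enum_rankK_in.
have iuC : i \in ~: u by rewrite inE.
by right; exists (enum_rank_in iuC i); rewrite enum_rankK_in.
Qed.

Lemma measurable_subvec : measurable_fun setT (@subvec R d u).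
Proof.
apply/measurable_fun_tnthP => j.
rewrite (_ : _ \o _ = fun x : d.-tuple R => tnth x (enum_val j)).
  exact: measurable_tnth.
by apply/funext => x /=; rewrite tnth_mktuple.
Qed.

Lemma measurable_merge : measurable_fun setT
  (fun p : #|u|.-tuple R * #|~: u|.-tuple R => merge p.1 p.2).
Proof.
apply/measurable_fun_tnthP => i.
have [[j ->]|[j ->]] := enum_val_split i.
- rewrite (_ : _ \o _ = (@tnth _ R ^~ j) \o fst).
    by apply: measurableT_comp => //; exact: measurable_tnth.
  by apply/funext => -[x y] /=; rewrite tnth_merge_enum.
- rewrite (_ : _ \o _ = (@tnth _ R ^~ j) \o snd).
    by apply: measurableT_comp => //; exact: measurable_tnth.
  by apply/funext => -[x y] /=; rewrite tnth_merge_enumC.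
Qed.

Lemma measurable_merge1 (x : #|u|.-tuple R) :
  measurable_fun setT (fun y : #|~: u|.-tuple R => merge x y).
Proof. exact: (measurableT_comp measurable_merge (measurable_pair1 x)). Qed.

Lemma prodmu_split (F : 'I_d -> \bar R) :
  (\prod_(i < d) F i = (\prod_(j < #|u|) F (enum_val j)) *
    (\prod_(j < #|~: u|) F (enum_val j)))%E.
Proof.
rewrite (bigID (mem u))/=; congr (_ * _)%E.
  by rewrite -big_enum_val.
by rewrite -big_enum_val; apply: eq_bigl => i; rewrite inE.
Qed.

(** Both sides give a box the product of the lengths of its sides, and boxes form a generating
    pi-system exhausted by cubes of finite measure. *)
Lemma lebesgue_tuple_merge (E : set (d.-tuple R)) : measurable E ->
  leb d E = (leb #|u| \x leb #|~: u|)%E ((fun p => merge p.1 p.2) @^-1` E).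
Proof.
pose nu : {measure set (d.-tuple R) -> \bar R} :=
  measure_function_pushforward__canonical__measure_function_Measure
    (leb #|u| \x leb #|~: u|)%E measurable_merge.
move=> mE; transitivity (nu E) => //; move: E mE.
apply: (measure_unique boxes
  (fun k => [set t | forall i, `[(- k%:R), k%:R]%classic (tnth t i)])).
- exact: measurable_tuple_boxes.
- exact: setI_closed_boxes.
- by move=> k; exists (fun=> `[(- k%:R), k%:R]%classic).
- exact: bigcup_box_itv.
- move=> _ [A mA ->]; apply: (eq_trans (lebesgue_tuple_box mA)); rewrite prodmu_split.
  rewrite -(lebesgue_tuple_box (fun j : 'I_#|u| => mA (enum_val j))).
  rewrite -(lebesgue_tuple_box (fun j : 'I_#|~: u| => mA (enum_val j))).
  rewrite -product_measure1E; last 2 first.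
    exact: (measurable_box (fun j : 'I_#|u| => mA (enum_val j))).
    exact: (measurable_box (fun j : 'I_#|~: u| => mA (enum_val j))).
  rewrite /nu /= /pushforward; congr (_ _).
  apply/seteqP; split => -[x y] /=.
    move=> [Ax Ay] i; have [[j ->]|[j ->]] := enum_val_split i.
      by rewrite tnth_merge_enum.
    by rewrite tnth_merge_enumC.
  move=> Axy; split => j.
    by have := Axy (enum_val j); rewrite tnth_merge_enum.
  by have := Axy (enum_val j); rewrite tnth_merge_enumC.
- move=> k.
  rewrite [ltLHS](lebesgue_tuple_box (fun=> measurable_itv `[(- k%:R), k%:R])).
  rewrite -ge0_fin_numE; last by apply: prode_ge0 => i _; exact: measure_ge0.
  apply: prode_fin_num => i _; rewrite lebesgue_measure_itv/=.
  by case: ifPn.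
Qed.

Lemma integral_merge (F : d.-tuple R -> \bar R) :
    measurable_fun setT F -> (forall x, 0 <= F x)%E ->
  (\int[leb d]_x F x =
   \int[leb #|u|]_x \int[leb #|~: u|]_y F (merge x y))%E.
Proof.
move=> mF F0.
pose nu : {measure set (d.-tuple R) -> \bar R} :=
  measure_function_pushforward__canonical__measure_function_Measure
    (leb #|u| \x leb #|~: u|)%E measurable_merge.
transitivity (\int[nu]_x F x)%E.
  apply: (eq_measure_integral nu) => A mA _; exact: lebesgue_tuple_merge.
rewrite ge0_integral_pushforward//; last exact: measurable_merge.
rewrite fubini_tonelli1//; last by move=> p; exact: F0.
exact: (measurableT_comp mF measurable_merge).
Qed.

End merge.

Arguments measurable_merge {R d u}.
Arguments measurable_subvec {R d u}.

(** * Programs *)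

Section program_lemmas.
Context {T V : Type} (phi : T -> V).

Lemma run_bind {A B} (p : program T V A) (q : A -> program T V B) :
  run phi (bind p q) = run phi (q (run phi p)).
Proof. by elim: p => //= x k IH. Qed.

(** The continuation is counted at the result of the first program, since later evaluations may
    depend on earlier values. *)
Lemma nb_evals_bind {A B} (p : program T V A) (q : A -> program T V B) :
  nb_evals phi (bind p q) = (nb_evals phi p + nb_evals phi (q (run phi p)))%N.
Proof. by elim: p => //= x k ->. Qed.

Lemma run_sum_prog {I : Type} {A : nmodType} (s : seq I)
    (p : I -> program T V A) :
  run phi (sum_prog s p) = \sum_(i <- s) run phi (p i).
Proof.
elim: s => [|i s IH]; first by rewrite big_nil.
by rewrite big_cons /= !run_bind IH.
Qed.

Lemma nb_evals_sum_prog {I : Type} {A : nmodType} (s : seq I)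
    (p : I -> program T V A) :
  nb_evals phi (sum_prog s p) = (\sum_(i <- s) nb_evals phi (p i))%N.
Proof.
elim: s => [|i s IH]; first by rewrite big_nil.
by rewrite big_cons /= !nb_evals_bind IH addn0.
Qed.

End program_lemmas.

Section estimation_program_lemmas.
Context {R : realType} {d : nat}.
Variables (D : 'I_d -> set R) (f g : d.-tuple R -> R) (t : R).
Variable phi : d.-tuple R -> R.

Lemma run_p_IS_ub_prog N (x : 'I_N -> d.-tuple R) :
  run phi (p_IS_ub_prog D f g t x) = p_IS_ub D f g t phi x.
Proof.
rewrite /p_IS_ub_prog run_bind run_sum_prog /= big_enum /=.
(* The program sums pairs formed by a weight and its square, with one evaluation per sample; the
   projections are additive. *)
by rewrite /p_IS_ub /p_IS raddf_sum/= raddf_sum.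
Qed.

Lemma run_TVE_PF_IS_prog (u : {set 'I_d}) Nu (xu : 'I_Nu -> #|u|.-tuple R)
    (y1 y2 : 'I_Nu -> #|~: u|.-tuple R) N (x : 'I_N -> d.-tuple R) :
  run phi (TVE_PF_IS_prog D f g t xu y1 y2 x) =
  TVE_PF_IS D f g t phi xu y1 y2 x.
Proof.
by rewrite /TVE_PF_IS_prog run_bind run_sum_prog run_bind run_p_IS_ub_prog/= big_enum.
Qed.

Lemma nb_evals_TVE_PF_IS_prog (u : {set 'I_d}) Nu
    (xu : 'I_Nu -> #|u|.-tuple R) (y1 y2 : 'I_Nu -> #|~: u|.-tuple R)
    N (x : 'I_N -> d.-tuple R) :
  nb_evals phi (TVE_PF_IS_prog D f g t xu y1 y2 x) =
  (2 * Nu + nb_evals phi (p_IS_ub_prog D f g t x))%N.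
Proof.
rewrite /TVE_PF_IS_prog nb_evals_bind nb_evals_bind addn0 nb_evals_sum_prog.
rewrite big_enum/=; congr addn.
by rewrite sum_nat_const card_ord mulnC.
Qed.

End estimation_program_lemmas.

(** * Means and independence *)

Section has_mean.
Local Open Scope ereal_scope.
Context {d} {O : measurableType d} {R : realType} (P : probability O R).
Implicit Types F G : O -> R.

(** Integrability is bundled with the value because linearity of the expectation requires it. *)
Definition has_mean F (c : R) : Prop :=
  P.-integrable setT (EFin \o F) /\ 'E_P[F] = c%:E.

(** For nonnegative variables a finite integral already gives integrability, so Tonelli computations
    suffice later on. *)
Lemma ge0_has_mean F c : measurable_fun setT F -> (forall w, (0 <= F w)%R) ->
  \int[P]_w (F w)%:E = c%:E -> has_mean F c.
Proof.
move=> mF F0 Fc; split; last by rewrite unlock.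
apply/integrableP; split; first exact/measurable_EFinP.
under eq_integral => w _ do rewrite /= ger0_norm//.
by rewrite Fc ltry.
Qed.

Lemma has_meanB F G a b : has_mean F a -> has_mean G b ->
  has_mean (F \- G)%R (a - b).
Proof.
move=> [iF Fa] [iG Gb]; split; first exact: (integrableB measurableT iF iG).
by rewrite expectationB ?Fa ?Gb//; exact/Lfun1_integrable.
Qed.

Lemma has_meanZ (k : R) F a : has_mean F a -> has_mean (fun w => k * F w)%R (k * a).
Proof.
move=> [iF Fa]; split; first exact: (integrableZl measurableT k iF).
move: Fa; rewrite unlock => Fa.
by under eq_integral do rewrite EFinM; rewrite integralZl// Fa.
Qed.

Lemma has_mean_sum {I : Type} (s : seq I) (Q : pred I) (F : I -> O -> R) a :
  (forall i, Q i -> has_mean (F i) (a i)) ->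
  has_mean (fun w => \sum_(i <- s | Q i) F i w)%R (\sum_(i <- s | Q i) a i).
Proof.
move=> Fa; elim: s => [|i s IH].
  rewrite big_nil (_ : (fun w => _) = cst 0%R); last first.
    by apply/funext => w; rewrite big_nil.
  by split; [exact: integrable0|rewrite expectation_cst].
rewrite big_cons (_ : (fun w => _) =
    if Q i then (F i \+ (fun w => \sum_(j <- s | Q j) F j w))%R
    else (fun w => \sum_(j <- s | Q j) F j w)%R); last first.
  by apply/funext => w; rewrite big_cons; case: (Q i).
case: ifPn => // Qi; have [iF FE] := Fa _ Qi; have [iS SE] := IH.
split; first exact: (integrableD measurableT iF iS).
by rewrite expectationD ?FE ?SE//; exact/Lfun1_integrable.
Qed.

End has_mean.

Section independence.
Local Open Scope ereal_scope.
Context {R : realType} {dO} {O : measurableType dO} (P : probability O R).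
Context {d} {T : measurableType d}.

Lemma mutually_independent_pair {I : finType} (X : I -> {RV P >-> T}) i j A B :
    mutually_independent X -> i != j -> measurable A -> measurable B ->
  P (X i @^-1` A `&` X j @^-1` B) = P (X i @^-1` A) * P (X j @^-1` B).
Proof.
move=> indX ij mA mB.
have := indX [set i; j]%SET (fun k => if k == i then A else B).
rewrite (_ : \bigcap_(k in _) _ = X i @^-1` A `&` X j @^-1` B); last first.
  apply/seteqP; split => [w Xw|w [Xi Xj] k /=].
    split; first by have := Xw i; rewrite /= !inE eqxx => /(_ isT).
    by have := Xw j; rewrite /= !inE eqxx orbT eq_sym (negbTE ij) => /(_ isT).
  rewrite !inE; have [->//|ki /=] := eqVneq k i.
  by move=> /eqP ->.
rewrite big_setU1 ?inE//= big_set1 eqxx eq_sym (negbTE ij); apply.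
by move=> k; case: ifP.
Qed.

(** Factorization on rectangles makes the joint law the product of the two laws; Tonelli then
    separates the integrals. *)
Lemma integral_independent_mul (X Y : {RV P >-> T}) (a b : T -> \bar R) :
    (forall A B, measurable A -> measurable B ->
      P (X @^-1` A `&` Y @^-1` B) = P (X @^-1` A) * P (Y @^-1` B)) ->
    measurable_fun setT a -> measurable_fun setT b ->
    (forall x, 0 <= a x) -> (forall x, 0 <= b x) ->
  \int[P]_w (a (X w) * b (Y w)) = \int[P]_w a (X w) * \int[P]_w b (Y w).
Proof.
move=> indXY ma mb a0 b0.
have mXY : measurable_fun setT (fun w => (X w, Y w)).
  by apply/measurable_fun_pair => /=.
pose nu : {measure set (T * T)%type -> \bar R} :=
  measure_function_pushforward__canonical__measure_function_Measure P mXY.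
have nuE E : measurable E ->
    (distribution P X \x distribution P Y) E = nu E.
  move=> mE; exact: product_measure_unique.
pose F (z : T * T) := a z.1 * b z.2.
have mF : measurable_fun setT F.
  by apply: emeasurable_funM; exact: measurableT_comp.
have F0 z : 0 <= F z by rewrite mule_ge0.
transitivity (\int[nu]_z F z).
  by rewrite ge0_integral_pushforward.
transitivity (\int[distribution P X \x distribution P Y]_z F z).
  by apply: eq_measure_integral => E mE _; rewrite -nuE.
rewrite fubini_tonelli1//= /fubini_F/= /F /=.
under eq_integral do rewrite ge0_integralZl//.
rewrite ge0_integralZr//; last exact: integral_ge0.
by rewrite !ge0_integral_distribution.
Qed.

End independence.

(** The squared sum has total coefficient 1/N^2 times 1 + 1/(N-1), that is 1/(N(N-1)), opposite to
    that of the sum of squares; only the off-diagonal products survive. *)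
Lemma sqr_mean_sub_var {R : numFieldType} N (w : 'I_N -> R) : (2 <= N)%N ->
  (N%:R^-1 * \sum_(n < N) w n) ^+ 2 -
  (N%:R - 1)^-1 * (N%:R^-1 * (\sum_(n < N) w n ^+ 2)
                   - (N%:R^-1 * \sum_(n < N) w n) ^+ 2) =
  (N%:R * (N%:R - 1))^-1 * \sum_(i < N) \sum_(j < N | j != i) w i * w j.
Proof.
move=> N2; have N0 : N%:R != 0 :> R by rewrite pnatr_eq0; case: N N2 w.
have N1 : N%:R - 1 != 0 :> R.
  by rewrite subr_eq0 -[1]/(1%:R) eqr_nat; case: N N2 {w N0} => [|[]].
have -> : \sum_(i < N) \sum_(j < N | j != i) w i * w j =
    (\sum_i w i) ^+ 2 - \sum_i w i ^+ 2.
  rewrite expr2 mulr_suml -sumrB; apply: eq_bigr => i _.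
  by rewrite mulr_sumr [X in _ = X - _](bigD1 i)//= -expr2 addrC addrK.
set S := \sum_i w i; set Q := \sum_i _.
by field; apply/andP; split.
Qed.

(** Canonical inference only sees [m1 \x m2] as a sigma-finite measure when both
    factors are finite, hence the explicit package [sfprod]. *)
Section sigma_finite_product.
Local Open Scope ereal_scope.
Context {d1 d2} {T1 : measurableType d1} {T2 : measurableType d2} {R : realType}.
Variable m1 : {sigma_finite_measure set T1 -> \bar R}.
Variable m2 : {sigma_finite_measure set T2 -> \bar R}.

Lemma sigma_finite_product : sigma_finite setT (m1 \x m2).
Proof.
have /sigma_finiteP[F [TF ndF Foo]] := sigma_finiteT m1.
have /sigma_finiteP[G [TG ndG Goo]] := sigma_finiteT m2.
exists (fun k => F k `*` G k).
  apply/seteqP; split => // -[x y] _.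
  have [k _ Fk] : (\bigcup_k F k) x by rewrite -TF.
  have [l _ Gl] : (\bigcup_k G k) y by rewrite -TG.
  exists (maxn k l) => //; split => /=.
    by move: x Fk; exact/subsetPset/ndF/leq_maxl.
  by move: y Gl; exact/subsetPset/ndG/leq_maxr.
move=> k; have [mF Fkoo] := Foo k; have [mG Gkoo] := Goo k.
split; first exact: measurableX.
by rewrite product_measure1E// lte_mul_pinfty// ge0_fin_numE.
Qed.

Definition sfprod : {sigma_finite_measure set (T1 * T2)%type -> \bar R} :=
  HB.pack (m1 \x m2) (Measure_isSigmaFinite.Build _ _ _ (m1 \x m2)
    sigma_finite_product).

End sigma_finite_product.

Lemma fubini_tonelli3 {d1 d2 d3} {T1 : measurableType d1}
    {T2 : measurableType d2} {T3 : measurableType d3} {R : realType}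
    (m1 : {sigma_finite_measure set T1 -> \bar R})
    (m2 : {sigma_finite_measure set T2 -> \bar R})
    (m3 : {sigma_finite_measure set T3 -> \bar R})
    (F : T1 * (T2 * T3) -> \bar R) :
    measurable_fun setT F -> (forall z, 0 <= F z)%E ->
  (\int[sfprod m1 (sfprod m2 m3)]_z F z =
   \int[m1]_x \int[m2]_y1 \int[m3]_y2 F (x, (y1, y2)))%E.
Proof.
move=> mF F0; rewrite fubini_tonelli1//; apply: eq_integral => x _.
rewrite /fubini_F fubini_tonelli1//.
exact: (measurableT_comp mF (measurable_pair1 x)).
Qed.

(** * Laws with densities and the joint law of a pick-freeze triple *)

Section densities.
Local Open Scope ereal_scope.
Context {R : realType}.
Local Notation leb := lebesgue_tuple.

Lemma integral_has_density {dO} {O : measurableType dO} (P : probability O R)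
    {n} (X : {RV P >-> n.-tuple R}) (h : n.-tuple R -> R)
    (F : n.-tuple R -> \bar R) :
    has_density X h -> measurable_fun setT h -> (forall x, (0 <= h x)%R) ->
    measurable_fun setT F -> (forall x, 0 <= F x) ->
  \int[P]_w F (X w) = \int[leb n]_x (F x * (h x)%:E).
Proof.
move=> Xh mh h0 mF F0.
rewrite -(ge0_integral_density mh h0 (nu := distribution P X))//.
by rewrite ge0_integral_distribution.
Qed.

Section joint_density.
Context {dO} {O : measurableType dO} (P : probability O R) {n m : nat}.
Variables (X : {RV P >-> n.-tuple R}) (Y1 Y2 : {RV P >-> m.-tuple R}).
Variables (p : n.-tuple R -> R) (h : n.-tuple R -> m.-tuple R -> R).
Hypotheses (mp : measurable_fun setT p) (p0 : forall x, (0 <= p x)%R).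
Hypotheses (mh : measurable_fun setT (fun z => h z.1 z.2)).
Hypotheses (h0 : forall x y, (0 <= h x y)%R).
(** Finiteness is asked for rather than total mass 1, since [cond_density] is identically 0 where
    the truncated marginal is 0. *)
Hypothesis hoo : forall x, \int[leb m]_y (h x y)%:E < +oo.
Hypotheses (Xp : has_density X p).
Hypotheses (Y1h : has_cond_density P X Y1 h) (Y2h : has_cond_density P X Y2 h).
Hypothesis Y12 : cond_independent P X Y1 Y2.

Let mh1 x : measurable_fun setT (h x).
Proof. exact: (measurableT_comp mh (measurable_pair1 x)). Qed.

Let mhE1 x : measurable_fun setT (EFin \o h x).
Proof. exact/measurable_EFinP. Qed.

Let H (B : set (m.-tuple R)) x := \int[leb m]_(y in B) (h x y)%:E.

Let HE B x : H B x = \int[leb m]_y ((h x y)%:E * (\1_B y)%:E).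
Proof. by rewrite /H integral_mkcond epatch_indic. Qed.

Let H_ge0 B x : 0 <= H B x.
Proof. by apply: integral_ge0 => y _; rewrite lee_fin. Qed.

Let H_fin B x : measurable B -> H B x \is a fin_num.
Proof.
move=> mB; rewrite ge0_fin_numE//; apply: le_lt_trans (hoo x).
apply: ge0_subset_integral => //; first exact: mhE1.
by move=> y _; rewrite lee_fin.
Qed.

Let mh1B x B : measurable B ->
  measurable_fun setT (fun y => (h x y)%:E * (\1_B y)%:E).
Proof.
move=> mB; apply: emeasurable_funM; first exact: mhE1.
by apply/measurable_EFinP; exact: measurable_indic.
Qed.

Let mH B : measurable B -> measurable_fun setT (H B).
Proof.
move=> mB; rewrite (funext (HE B)).
apply: (measurable_fun_fubini_tonelli_F
  (fun z : n.-tuple R * m.-tuple R => (h z.1 z.2)%:E * (\1_B z.2)%:E)).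
  apply: emeasurable_funM; first exact/measurable_EFinP.
  by apply/measurable_EFinP; apply: (measurableT_comp _ measurable_snd).
by move=> z; rewrite mule_ge0 ?lee_fin.
Qed.

(** By conditional independence, [H B x * H C x] at [x = X w] is a version of the conditional
    probability of the event on [Y1] and [Y2]. It is integrated over the event that [X] lies in [A],
    which belongs to the sigma-algebra generated by [X]. *)
Lemma prob_rectangle A B C : measurable A -> measurable B -> measurable C ->
  P (X @^-1` A `&` (Y1 @^-1` B `&` Y2 @^-1` C)) =
  \int[leb n]_x ((\1_A x)%:E * (H B x * H C x) * (p x)%:E).
Proof.
move=> mA mB mC.
have [_ _ /(_ (X @^-1` A))] := Y12 mB mC (Y1h mB) (Y2h mC).
have mXA : measurable (X @^-1` A) by exact: measurable_funPTI.
have mYB : measurable (Y1 @^-1` B) by exact: measurable_funPTI.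
have mYC : measurable (Y2 @^-1` C) by exact: measurable_funPTI.
move=> /(_ _); have XA : preimage_set_system setT X measurable (X @^-1` A).
  by exists A => //; rewrite setTI.
move=> /(_ XA); rewrite integral_indic//; last exact: measurableI.
rewrite [X in P X]setIC => <-.
rewrite -(integral_has_density (X := X) (F := fun x => (\1_A x)%:E * (H B x * H C x)))//.
- rewrite integral_mkcond epatch_indic; apply: eq_integral => w _.
  rewrite /= EFinM muleC; congr (_ * (_ * _)).
    by rewrite fineK// H_fin.
  by rewrite fineK// H_fin.
- apply: emeasurable_funM; first exact/measurable_EFinP.
  by apply: emeasurable_funM; exact: mH.
- by move=> x; rewrite !mule_ge0 ?lee_fin.
Qed.

(** The joint density of [(X, (Y1, Y2))]. *)
Let k (z : n.-tuple R * (m.-tuple R * m.-tuple R)) : R :=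
  (p z.1 * (h z.1 z.2.1 * h z.1 z.2.2))%R.

Let mk : measurable_fun setT k.
Proof.
apply: measurable_funM; first exact: measurableT_comp.
apply: measurable_funM.
  apply: (measurableT_comp mh (g := fun z : n.-tuple R * (m.-tuple R * m.-tuple R) =>
    (z.1, z.2.1))).
  by apply/measurable_fun_pair => //=; exact: measurableT_comp.
apply: (measurableT_comp mh (g := fun z : n.-tuple R * (m.-tuple R * m.-tuple R) =>
  (z.1, z.2.2))).
by apply/measurable_fun_pair => //=; exact: measurableT_comp.
Qed.

Let k0 z : (0 <= k z)%R.
Proof. by rewrite !mulr_ge0. Qed.

(** By [prob_rectangle], the law of the triple and the measure of density [k] agree on rectangles,
    hence everywhere. *)
Lemma integral_joint_density (F : n.-tuple R * (m.-tuple R * m.-tuple R) -> \bar R) :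
    measurable_fun setT F -> (forall z, 0 <= F z) ->
  \int[P]_w F (X w, (Y1 w, Y2 w)) =
  \int[leb n]_x \int[leb m]_y1 \int[leb m]_y2
    (F (x, (y1, y2)) * (p x * (h x y1 * h x y2))%:E).
Proof.
move=> mF F0.
have mXY : measurable_fun setT (fun w => (X w, (Y1 w, Y2 w))).
  by apply/measurable_fun_pair => //=; exact/measurable_fun_pair.
pose nu : {measure set (n.-tuple R * (m.-tuple R * m.-tuple R))%type -> \bar R} :=
  measure_function_pushforward__canonical__measure_function_Measure P mXY.
transitivity (\int[nu]_z F z); first by rewrite ge0_integral_pushforward.
rewrite (ge0_integral_density (m := sfprod (leb n) (sfprod (leb m) (leb m))) mk k0)//.
  rewrite fubini_tonelli3//.
    by apply: emeasurable_funM => //; exact/measurable_EFinP.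
  by move=> z; rewrite mule_ge0 ?lee_fin.
move=> E mE.
rewrite (_ : \int[_]_(x in _) _ =
  mdensity (sfprod (leb n) (sfprod (leb m) (leb m))) mk k0 E)//.
apply: eq_measure_rectangle3 => // [|A B C mA mB mC].
  by rewrite /nu/= /pushforward preimage_setT probability_setT ltry.
rewrite [LHS]prob_rectangle// [RHS](_ : _ =
  \int[sfprod (leb n) (sfprod (leb m) (leb m))]_(z in A `*` (B `*` C)) (k z)%:E)//.
rewrite [RHS]integral_mkcond epatch_indic.
rewrite fubini_tonelli3; last 2 first.
- apply: emeasurable_funM; first exact/measurable_EFinP.
  by apply/measurable_EFinP; exact: measurable_indic (measurableX mA (measurableX mB mC)).
- by move=> z; rewrite mule_ge0 ?lee_fin.
apply: eq_integral => x _.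
transitivity (\int[leb m]_y1 ((\1_A x * p x)%:E * ((h x y1)%:E * (\1_B y1)%:E) * H C x)).
  rewrite ge0_integralZr//; last 2 first.
  - by apply: emeasurable_funM => //; exact: mh1B.
  - by move=> y _; rewrite !mule_ge0 ?lee_fin ?mulr_ge0.
  rewrite ge0_integralZl//; last 3 first.
  - exact: mh1B.
  - by move=> y _; rewrite !mule_ge0 ?lee_fin.
  - by rewrite lee_fin mulr_ge0.
  by rewrite -HE EFinM muleAC -!muleA.
apply: eq_integral => y1 _; rewrite HE -ge0_integralZl//; last 3 first.
- exact: mh1B.
- by move=> y _; rewrite mule_ge0 ?lee_fin.
- by rewrite !mule_ge0 ?lee_fin ?mulr_ge0.
apply: eq_integral => y2 _; rewrite -!EFinM /k /= !indicE !in_setX.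
case: (x \in A) => /=; last by rewrite !(mul0r, mulr0).
case: (y1 \in B) => /=; last by rewrite !(mul0r, mulr0).
by congr EFin; rewrite !(mul1r, mulr1); ring.
Qed.

End joint_density.

End densities.

(** * Variances and versions of conditional expectations *)

Section variance.
Local Open Scope ereal_scope.
Context {d} {O : measurableType d} {R : realType} (P : probability O R).

Lemma has_mean_variance (Z : O -> R) a v :
  has_mean P Z a -> has_mean P (fun w => Z w ^+ 2)%R v ->
  'V_P[Z] = (v - a ^+ 2)%:E.
Proof.
move=> Za Z2v.
have ka : has_mean P (cst (a ^+ 2))%R (a ^+ 2).
  by split; [exact: finite_measure_integrable_cst|exact: expectation_cst].
(* The square of [Z - a] is split as [Z ^+ 2 - (2 * a * Z - a ^+ 2)]. *)
have [_] := has_meanB Z2v (has_meanB (has_meanZ (2 * a)%R Za) ka).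
rewrite (_ : v - (2 * a * a - a ^+ 2) = v - a ^+ 2)%R; last by ring.
move=> <-; rewrite /variance covariance.unlock; congr ('E_P[_]).
have [_ ->] := Za; apply/funext => w /=; rewrite fctE/=; ring.
Qed.

(** Lets an explicit version stand in for the arbitrarily chosen [cond_exp]; both have the same
    expectation after any measurable function. *)
Lemma variance_ae_eq (Z Z' : O -> R) :
  measurable_fun setT Z -> measurable_fun setT Z' ->
  {ae P, forall w, Z w = Z' w} -> 'V_P[Z] = 'V_P[Z'].
Proof.
move=> mZ mZ' ZZ'.
have expE (k : R -> R) : measurable_fun setT k -> 'E_P[k \o Z] = 'E_P[k \o Z'].
  move=> mk; rewrite unlock; apply: ae_eq_integral => //.
  - by apply/measurable_EFinP; exact: measurableT_comp.
  - by apply/measurable_EFinP; exact: measurableT_comp.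
  - by apply: filterS ZZ' => w /= -> .
have /= E1 := expE id (@measurable_id _ _ _).
rewrite /variance covariance.unlock (_ : 'E_P[Z] = 'E_P[Z'])//.
set c := fine _.
apply: (expE (fun x => (x - c) * (x - c))%R).
by apply: measurable_funM; exact: measurable_funB.
Qed.

End variance.

Section conditional_expectation.
Local Open Scope ereal_scope.
Context {R : realType} {dO} {O : measurableType dO} (P : probability O R).
Context {dT} {T : measurableType dT} (X : O -> T) (Y : O -> R).
Hypothesis mX : measurable_fun setT X.

Lemma measurable_is_cond_exp Z : is_cond_exp P X Y Z -> measurable_fun setT Z.
Proof. by move=> [_ /integrableP[/measurable_EFinP]]. Qed.

(** The event [E] where [Z' < Z] lies in the sigma-algebra generated by [X], so both variables have
    the same integral over it; the positive difference then integrates to 0 and [E] is null. *)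
Lemma is_cond_exp_ae_le Z Z' : is_cond_exp P X Y Z -> is_cond_exp P X Y Z' ->
  {ae P, forall w, (Z w <= Z' w)%R}.
Proof.
move=> [mZ iZ ZE] [mZ' iZ' Z'E]; pose E := [set w | (Z' w < Z w)%R].
have XE : preimage_set_system setT X measurable E.
  (* [Z] is retyped on [O] with the sigma-algebra generated by [X], so that measurability of the
     comparison places [E] in that sigma-algebra. *)
  have mz : measurable_fun setT (Z : g_sigma_algebra_preimageType X -> R).
    by move=> _ B mB; rewrite setTI; exact: mZ.
  have mz' : measurable_fun setT (Z' : g_sigma_algebra_preimageType X -> R).
    by move=> _ B mB; rewrite setTI; exact: mZ'.
  have := measurable_fun_ltr mz' mz measurableT (Y := [set true]).
  by rewrite setTI; apply.
have mE : measurable E by have [B mB <-] := XE; exact: mX.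
have iZE : P.-integrable E (EFin \o Z) by apply: integrableS iZ.
have iZE' : P.-integrable E (EFin \o Z') by apply: integrableS iZ'.
have iB := integrableB mE iZE iZE'.
have : \int[P]_(w in E) `|(Z w)%:E - (Z' w)%:E| = 0.
  transitivity (\int[P]_(w in E) ((Z w)%:E - (Z' w)%:E)).
    apply: eq_integral => w; rewrite inE /E /= => Z'Z.
    by rewrite ger0_norm// subr_ge0 ltW.
  rewrite integralB// ZE// Z'E// subee// -ZE//.
  exact: integrable_fin_num.
move/(ae_eq_integral_abs P mE (measurable_int P iB)).
apply: filterS => w /= Ew; rewrite leNgt; apply/negP => Z'Z.
have := Ew Z'Z; rewrite -EFinB => -[] /eqP.
by rewrite subr_eq0 => /eqP ZZ'; move: Z'Z; rewrite ZZ' ltxx.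
Qed.

(** The existence of [Z] ensures that the choice does not fall back on the default; two opposite
    inequalities give equality. *)
Lemma cond_exp_ae_eq Z : is_cond_exp P X Y Z ->
  is_cond_exp P X Y (cond_exp P X Y) /\ {ae P, forall w, cond_exp P X Y w = Z w}.
Proof.
move=> YZ; have Yc : is_cond_exp P X Y (cond_exp P X Y).
  by apply: (@xgetPex _ (fun=> 0%R) [set Z | is_cond_exp P X Y Z]); exists Z.
split => //; apply: filterS2 (is_cond_exp_ae_le Yc YZ) (is_cond_exp_ae_le YZ Yc).
by move=> w cZ Zc; apply/eqP; rewrite eq_le cZ.
Qed.

End conditional_expectation.

(** * Importance weights *)

(** Inversion is discontinuous at 0, where its value is 0 by convention, but continuous on the open
    complement of that point. *)
Lemma measurable_invr (R : realType) : measurable_fun setT (@GRing.inv R).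
Proof.
rewrite -(setUv [set 0%R]); apply/measurable_funU => //; first exact: measurableC.
split; first exact: measurable_fun_set1.
apply: open_continuous_measurable_fun.
  by apply: closed_openC; exact: closed_eq.
by move=> x; rewrite inE /= => /eqP x0; exact: inv_continuous.
Qed.

(** * Marginal densities *)

Section marginals.
Local Open Scope ereal_scope.
Context {R : realType} {d : nat} (u : {set 'I_d}).
Local Notation leb := lebesgue_tuple.
Implicit Types h : d.-tuple R -> R.

(** [marginal] before the truncation by [fine] of its infinite values. *)
Definition emarginal h (x : #|u|.-tuple R) : \bar R :=
  \int[leb #|~: u|]_y (h (merge x y))%:E.

Lemma marginalE h x : marginal h x = fine (emarginal h x).
Proof. by []. Qed.

Section ge0.
Variable h : d.-tuple R -> R.
Hypotheses (mh : measurable_fun setT h) (h0 : forall x, (0 <= h x)%R).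

Lemma emarginal_ge0 (x : #|u|.-tuple R) : 0 <= emarginal h x.
Proof. by apply: integral_ge0 => y _; rewrite lee_fin. Qed.

Lemma marginal_ge0 (x : #|u|.-tuple R) : (0 <= marginal h x)%R.
Proof. exact/fine_ge0/emarginal_ge0. Qed.

Lemma measurable_emarginal : measurable_fun setT (emarginal h).
Proof.
apply: (measurable_fun_fubini_tonelli_F 
  (fun z : #|u|.-tuple R * #|~: u|.-tuple R => (h (merge z.1 z.2))%:E)).
  by apply/measurable_EFinP; exact: (measurableT_comp mh measurable_merge).
by move=> z; rewrite lee_fin.
Qed.

Lemma measurable_marginal : measurable_fun setT (@marginal R d u h).
Proof. exact: (measurableT_comp (fine_measurable measurableT) measurable_emarginal). Qed.

Lemma integral_subvec (a : #|u|.-tuple R -> \bar R) :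
    measurable_fun setT a -> (forall x, 0 <= a x) ->
  \int[leb d]_x (a (subvec u x) * (h x)%:E) = \int[leb #|u|]_x (a x * emarginal h x).
Proof.
move=> ma a0; rewrite (integral_merge u); last 2 first.
- apply: emeasurable_funM; last exact/measurable_EFinP.
  exact: (measurableT_comp ma measurable_subvec).
- by move=> x; rewrite mule_ge0 ?lee_fin.
apply: eq_integral => x _; rewrite -ge0_integralZl//; last 2 first.
- by apply/measurable_EFinP; exact: (measurableT_comp mh (measurable_merge1 x)).
- by move=> y _; rewrite lee_fin.
by apply: eq_integral => y _; rewrite (subvec_merge x y).1.
Qed.

(** By Tonelli the integral of the marginal is that of [h], and an integrable function is finite
    almost everywhere. *)
Lemma emarginal_fin_ae : \int[leb d]_x (h x)%:E < +oo ->
  {ae leb #|u|, forall x, emarginal h x \is a fin_num}.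
Proof.
move=> hoo; have ih : (leb #|u|).-integrable setT (emarginal h).
  apply/integrableP; split; first exact: measurable_emarginal.
  under eq_integral do rewrite gee0_abs ?emarginal_ge0//.
  rewrite (integral_merge u) in hoo => //.
  exact/measurable_EFinP.
by have := integrable_ae measurableT ih; apply: filterS => x; exact.
Qed.

End ge0.
End marginals.

Section importance_weights.
Local Open Scope ereal_scope.
Context {R : realType} {d : nat} (u : {set 'I_d}).
Local Notation leb := lebesgue_tuple.
Variables (f g b : d.-tuple R -> R).
Hypotheses (mf : measurable_fun setT f) (f0 : forall x, (0 <= f x)%R).
Hypothesis f1 : \int[leb d]_x (f x)%:E = 1.
Hypotheses (mg : measurable_fun setT g) (g0 : forall x, (0 <= g x)%R).
Hypothesis g1 : \int[leb d]_x (g x)%:E = 1.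
Hypotheses (mb : measurable_fun setT b) (b0 : forall x, (0 <= b x)%R).
Hypothesis b1 : forall x, (b x <= 1)%R.
Hypothesis bfg : forall x, g x = 0%R -> (b x * f x = 0)%R.

Let bf x : R := (b x * f x)%R.
Let w x : R := (b x * f x / g x)%R.

Let mbf : measurable_fun setT bf.
Proof. exact: measurable_funM. Qed.

Let bf0 x : (0 <= bf x)%R.
Proof. exact: mulr_ge0. Qed.

Let bf_le x : (bf x <= f x)%R.
Proof. exact: ler_piMl. Qed.

Let w0 x : (0 <= w x)%R.
Proof. by rewrite /w divr_ge0 ?mulr_ge0. Qed.

Let mw : measurable_fun setT w.
Proof. exact: measurable_funM (measurableT_comp (@measurable_invr R) mg). Qed.

(** Where [g] vanishes the weight is 0 by convention, and [bfg] makes [bf] vanish as well. *)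
Let w_g x : (w x * g x = bf x)%R.
Proof.
rewrite /w /bf; have [gx0|gx0] := eqVneq (g x) 0%R; last by rewrite divfK.
by rewrite gx0 mulr0 bfg.
Qed.

Let s : #|u|.-tuple R -> R := marginal bf.

(** [E_f(b(X) | X_u)] as a function of [X_u]; it is [0] where [marginal f]
    vanishes. *)
Definition regression : #|u|.-tuple R -> R := fun x => (s x / marginal f x)%R.

Let emarginal_bf_le (x : #|u|.-tuple R) : emarginal bf x <= emarginal f x.
Proof.
apply: ge0_le_integral => //; do ?[by move=> y _; rewrite lee_fin].
- by apply/measurable_EFinP; exact: (measurableT_comp mbf (measurable_merge1 x)).
- by apply/measurable_EFinP; exact: (measurableT_comp mf (measurable_merge1 x)).
Qed.

(** Domination by [f] makes the marginal of [bf] finite whenever that of [f] is, so [fine] changes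
    nothing. *)
Let emarginal_bfE (x : #|u|.-tuple R) :
  emarginal f x \is a fin_num -> emarginal bf x = (s x)%:E.
Proof.
move=> fx; rewrite /s marginalE fineK//.
rewrite ge0_fin_numE ?emarginal_ge0// (le_lt_trans (emarginal_bf_le x))//.
by rewrite -ge0_fin_numE ?emarginal_ge0.
Qed.

Let s_le (x : #|u|.-tuple R) : emarginal f x \is a fin_num -> (s x <= marginal f x)%R.
Proof.
by move=> fx; rewrite -lee_fin -emarginal_bfE// marginalE fineK// emarginal_bf_le.
Qed.

Lemma regression_ge0 x : (0 <= regression x)%R.
Proof. by rewrite divr_ge0 ?marginal_ge0. Qed.

(** Valid at every point: where the marginal of [f] is 0 or infinite, [marginal f x] is 0 and so is
    the quotient. *)
Lemma regression_le1 x : (regression x <= 1)%R.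
Proof.
rewrite /regression; have [->|fx0] := eqVneq (marginal f x) 0%R.
  by rewrite invr0 mulr0.
have fx : emarginal f x \is a fin_num.
  by move: fx0; rewrite marginalE; case: (emarginal f x) => //=; rewrite eqxx.
by rewrite ler_pdivrMr ?mul1r ?s_le// lt_neqAle eq_sym fx0 marginal_ge0.
Qed.

Lemma measurable_regression : measurable_fun setT regression.
Proof.
apply: measurable_funM; first exact: measurable_marginal.
by apply: (measurableT_comp (@measurable_invr R)); exact: measurable_marginal.
Qed.

Let f_ae : {ae leb #|u|, forall x, emarginal f x \is a fin_num}.
Proof. by apply: emarginal_fin_ae => //; rewrite f1 ltry. Qed.

Let g_ae : {ae leb #|u|, forall x, emarginal g x \is a fin_num}.
Proof. by apply: emarginal_fin_ae => //; rewrite g1 ltry. Qed.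

(** Where [marginal f] vanishes, the bound of [s] by it gives [s x = 0], so the division by 0 does
    no harm. *)
Let regression_emarginal (x : #|u|.-tuple R) : emarginal f x \is a fin_num ->
  (regression x)%:E * emarginal f x = emarginal bf x.
Proof.
move=> fx; rewrite emarginal_bfE// -[in LHS](fineK fx) -marginalE -EFinM.
congr EFin; rewrite /regression; have [fx0|fx0] := eqVneq (marginal f x) 0%R.
  rewrite fx0 mulr0; apply/esym/eqP; rewrite eq_le marginal_ge0// andbT.
  by rewrite -fx0 s_le.
by rewrite divfK.
Qed.

Definition regression_moment2 : \bar R := \int[leb #|u|]_x (s x ^+ 2 / marginal f x)%:E.

Let moment2_ge0 x : (0 <= s x ^+ 2 / marginal f x)%R.
Proof. by rewrite divr_ge0 ?sqr_ge0 ?marginal_ge0. Qed.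

Let measurable_moment2 :
  measurable_fun setT (fun x : #|u|.-tuple R => (s x ^+ 2 / marginal f x)%R).
Proof.
apply: measurable_funM.
  exact: (measurable_funX 2 (measurable_marginal (u:=u) mbf bf0)).
by apply: (measurableT_comp (@measurable_invr R)); exact: measurable_marginal.
Qed.

(** * The conditional expectation under the target density *)

Section target.
Context {dO} {O : measurableType dO} (P : probability O R).
Variable X : {RV P >-> d.-tuple R}.
Hypothesis Xf : has_density X f.

Lemma integral_regression_sqr :
  \int[P]_w (regression (subvec u (X w)) ^+ 2)%:E = regression_moment2.
Proof.
have mr2 : measurable_fun setT (fun x => (regression x ^+ 2)%:E).
  by apply/measurable_EFinP; exact: (measurable_funX 2 measurable_regression).
rewrite (integral_has_density (F := fun x => (regression (subvec u x) ^+ 2)%:E) Xf)//.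
- rewrite (integral_subvec mf f0 mr2); last by move=> x; rewrite lee_fin sqr_ge0.
  apply: ge0_ae_eq_integral => //.
  + by apply: emeasurable_funM => //; exact: measurable_emarginal.
  + by apply/measurable_EFinP; exact: measurable_moment2.
  + by move=> x _; rewrite mule_ge0 ?emarginal_ge0 ?lee_fin ?sqr_ge0.
  + by move=> x _; rewrite lee_fin.
  + apply: filterS f_ae => x fx _.
    rewrite expr2 EFinM -muleA regression_emarginal// emarginal_bfE// -EFinM.
    by rewrite /regression expr2 mulrAC.
- exact: (measurableT_comp mr2 measurable_subvec).
- by move=> x; rewrite lee_fin sqr_ge0.
Qed.

(** [regression] takes its values in [0, 1], so its second moment under the probability [P] is at
    most 1. *)
Lemma regression_moment2_fin_num : regression_moment2 \is a fin_num.
Proof.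
rewrite ge0_fin_numE; last by apply: integral_ge0 => x _; rewrite lee_fin.
rewrite -integral_regression_sqr; apply: (@le_lt_trans _ _ (\int[P]_w cst 1 w)).
  apply: ge0_le_integral => //; do ?[by move=> o _; rewrite lee_fin sqr_ge0].
    apply/measurable_EFinP; apply: (measurable_funX 2).
    apply: (measurableT_comp measurable_regression).
    exact: (measurableT_comp measurable_subvec).
  by move=> o _; rewrite lee_fin expr_le1 ?regression_ge0 ?regression_le1.
by rewrite integral_cst//= mul1e probability_setT ltry.
Qed.

Lemma integral_target : \int[P]_w (b (X w))%:E = \int[leb d]_x (b x * f x)%:E.
Proof.
rewrite (integral_has_density (F := EFin \o b) Xf)//; first exact/measurable_EFinP.
Qed.

(** Over the event that the sub-vector lies in [A], [integral_subvec] is used with [f] on one side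
    and with [bf] on the other; [regression_emarginal] identifies the integrands almost
    everywhere. *)
Lemma is_cond_exp_regression :
  is_cond_exp P (subvec u \o X) (b \o X) (regression \o (subvec u \o X)).
Proof.
have mr := measurable_regression.
have mrX : measurable_fun setT (regression \o (subvec u \o X)).
  by apply: (measurableT_comp mr); exact: (measurableT_comp measurable_subvec).
split.
- move=> B mB; exists (regression @^-1` B); last by rewrite setTI.
  by rewrite -[X in measurable X]setTI; exact: mr.
- have := finite_measure_integrable_cst P 1 measurableT.
  apply: le_integrable => //.
    exact/measurable_EFinP.
  by move=> x _; rewrite /= lee_fin normr1 ger0_norm ?regression_le1 ?regression_ge0.
- move=> _ [A mA <-]; rewrite setTI !(integral_mkcond ((_ \o _) @^-1` _)) !epatch_indic.
  have m1A : measurable_fun setT (fun x : #|u|.-tuple R => (\1_A x : R)%:E).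
    by apply/measurable_EFinP; exact: measurable_indic.
  have m1As : measurable_fun setT (fun x : d.-tuple R => (\1_A (subvec u x) : R)%:E).
    exact: (measurableT_comp m1A measurable_subvec).
  have mrs : measurable_fun setT (regression \o subvec u).
    exact: (measurableT_comp mr measurable_subvec).
  rewrite [LHS](integral_has_density
    (F := fun x => (regression (subvec u x))%:E * (\1_A (subvec u x))%:E) Xf)//.
  + rewrite [RHS](integral_has_density
      (F := fun x => (b x)%:E * (\1_A (subvec u x))%:E) Xf)//.
    * under [RHS]eq_integral do rewrite muleAC muleC -EFinM.
      rewrite (integral_subvec mbf bf0 m1A)//.
      rewrite (integral_subvec mf f0 (a := fun x => (regression x)%:E * (\1_A x)%:E))//.
      - apply: ge0_ae_eq_integral => //.
        + apply: emeasurable_funM; last exact: measurable_emarginal.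
          by apply: emeasurable_funM => //; exact/measurable_EFinP.
        + by apply: emeasurable_funM => //; exact: measurable_emarginal.
        + by move=> x _; rewrite !mule_ge0 ?emarginal_ge0 ?lee_fin ?regression_ge0.
        + by move=> x _; rewrite !mule_ge0 ?emarginal_ge0 ?lee_fin.
        + apply: filterS f_ae => x fx _.
          by rewrite muleAC regression_emarginal// muleC.
      - by apply: emeasurable_funM => //; exact/measurable_EFinP.
      - by move=> x; rewrite mule_ge0 ?lee_fin ?regression_ge0.
    * by apply: emeasurable_funM => //; exact/measurable_EFinP.
    * by move=> x; rewrite mule_ge0 ?lee_fin.
  + by apply: emeasurable_funM => //; exact/measurable_EFinP.
  + by move=> x; rewrite mule_ge0 ?lee_fin ?regression_ge0.
Qed.

End target.

Lemma integral_weight {dO} {O : measurableType dO} (P : probability O R)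
    (X : {RV P >-> d.-tuple R}) : has_density X g ->
  \int[P]_o (w (X o))%:E = \int[leb d]_x (b x * f x)%:E.
Proof.
move=> Xg; rewrite (integral_has_density (F := EFin \o w) Xg)//.
- by apply: eq_integral => x _; rewrite /= -EFinM w_g.
- exact/measurable_EFinP.
Qed.

(** * The mean of a pick-freeze term *)

Section pick_freeze.
Context {dO} {O : measurableType dO} (P : probability O R).
Variables (X : {RV P >-> #|u|.-tuple R}) (Y1 Y2 : {RV P >-> #|~: u|.-tuple R}).
Hypothesis Xg : has_density X (marginal g).
Hypothesis Y1g : has_cond_density P X Y1 (cond_density g).
Hypothesis Y2g : has_cond_density P X Y2 (cond_density g).
Hypothesis Y12 : cond_independent P X Y1 Y2.

Let measurable_cond_density : measurable_fun setT
  (fun z : #|u|.-tuple R * #|~: u|.-tuple R => cond_density g z.1 z.2).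
Proof.
apply: measurable_funM; first exact: (measurableT_comp mg measurable_merge).
apply: (measurableT_comp (@measurable_invr R)).
by apply: (measurableT_comp _ measurable_fst); exact: measurable_marginal.
Qed.

Let cond_density_ge0 (x : #|u|.-tuple R) y : (0 <= cond_density g x y)%R.
Proof. by rewrite divr_ge0 ?marginal_ge0. Qed.

Let integral_cond_density (x : #|u|.-tuple R) :
  \int[leb #|~: u|]_y (cond_density g x y)%:E < +oo.
Proof.
rewrite /cond_density; under eq_integral do rewrite EFinM.
rewrite ge0_integralZr//; last 3 first.
- by apply/measurable_EFinP; exact: (measurableT_comp mg (measurable_merge1 x)).
- by move=> y _; rewrite lee_fin.
- by rewrite lee_fin invr_ge0 marginal_ge0.
rewrite -/(emarginal g x) marginalE; have := emarginal_ge0 g0 x.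
(* An infinite marginal is truncated to 0, whose inverse is 0, so the product is 0 there. *)
by case: (emarginal g x) => [r _||]//=; rewrite ?ltry// invr0 mule0.
Qed.

Let integral_weight_cond_density (x : #|u|.-tuple R) :
  \int[leb #|~: u|]_y (w (merge x y) * cond_density g x y)%:E =
  (marginal g x)^-1%:E * emarginal bf x.
Proof.
rewrite -ge0_integralZl//; last 3 first.
- by apply/measurable_EFinP; exact: (measurableT_comp mbf (measurable_merge1 x)).
- by move=> y _; rewrite lee_fin.
- by rewrite lee_fin invr_ge0 marginal_ge0.
by apply: eq_integral => y _; rewrite -EFinM /cond_density mulrA w_g mulrC.
Qed.

(** Settles the points where the division by [marginal g] degenerates: finiteness turns
    [marginal g x = 0] into a zero integral, so [g], and with it [bf], vanishes almost everywhere on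
    the slice. *)
Let marginal_eq0 x : emarginal f x \is a fin_num ->
  emarginal g x \is a fin_num -> marginal g x = 0%R -> s x = 0%R.
Proof.
move=> fx gx gx0.
have mgx : measurable_fun setT (fun y => (g (merge x y))%:E).
  by apply/measurable_EFinP; exact: (measurableT_comp mg (measurable_merge1 x)).
have mbfx : measurable_fun setT (fun y => (bf (merge x y))%:E).
  by apply/measurable_EFinP; exact: (measurableT_comp mbf (measurable_merge1 x)).
have /(ae_eq_integral_abs _ measurableT mgx) g_eq0 :
    \int[leb #|~: u|]_y `|(g (merge x y))%:E| = 0.
  under eq_integral do rewrite gee0_abs ?lee_fin//.
  by rewrite -/(emarginal g x) -(fineK gx) -marginalE gx0.
have bf_eq0 : emarginal bf x = 0.
  rewrite -(integral0 (leb #|~: u|) setT); apply: ae_eq_integral => //.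
  apply: filterS g_eq0 => y /(_ I)[gy0] _.
  by rewrite /= /bf bfg.
by apply/EFin_inj; rewrite -emarginal_bfE.
Qed.

Lemma integral_weight_pair :
  \int[P]_o (w (merge (X o) (Y1 o)) * w (merge (X o) (Y2 o)) *
    (marginal g (X o) / marginal f (X o)))%:E = regression_moment2.
Proof.
pose F (z : #|u|.-tuple R * (#|~: u|.-tuple R * #|~: u|.-tuple R)) : R :=
  (w (merge z.1 z.2.1) * w (merge z.1 z.2.2) *
  (marginal g z.1 / marginal f z.1))%R.
have mmerge (i : #|~: u|.-tuple R * #|~: u|.-tuple R -> #|~: u|.-tuple R) :
    measurable_fun setT i -> measurable_fun setT
    (fun z : #|u|.-tuple R * (#|~: u|.-tuple R * #|~: u|.-tuple R) =>
      w (merge z.1 (i z.2))).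
  move=> mi; apply: (measurableT_comp mw); apply: (measurableT_comp measurable_merge
    (g := fun z : #|u|.-tuple R * (#|~: u|.-tuple R * #|~: u|.-tuple R) =>
      (z.1, i z.2))).
  by apply/measurable_fun_pair => //=; exact: measurableT_comp.
have mF : measurable_fun setT F.
  apply: measurable_funM; first by apply: measurable_funM; exact: mmerge.
  apply: (measurable_funM (f := fun z => marginal g z.1)
    (g := fun z => (marginal f z.1)^-1%R)).
    by apply: (measurableT_comp _ measurable_fst); exact: measurable_marginal.
  apply: (measurableT_comp (@measurable_invr R)).
  by apply: (measurableT_comp _ measurable_fst); exact: measurable_marginal.
have F0 z : (0 <= F z)%R by rewrite !mulr_ge0 ?invr_ge0 ?marginal_ge0.
rewrite (integral_joint_density (measurable_marginal (u:=u) mg g0)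
  (marginal_ge0 (u:=u) g0) measurable_cond_density cond_density_ge0
  integral_cond_density Xg Y1g Y2g Y12 (F := EFin \o F))//; last first.
  exact/measurable_EFinP.
pose J (x : #|u|.-tuple R) := (marginal g x)^-1%:E * emarginal bf x.
pose c (x : #|u|.-tuple R) := (marginal g x * (marginal g x / marginal f x))%R.
have c0 x : (0 <= c x)%R by rewrite !mulr_ge0 ?invr_ge0 ?marginal_ge0.
have J0 x : 0 <= J x by rewrite mule_ge0 ?emarginal_ge0// lee_fin invr_ge0 marginal_ge0.
have mJ : measurable_fun setT J.
  apply: emeasurable_funM; last exact: measurable_emarginal.
  apply/measurable_EFinP; apply: (measurableT_comp (@measurable_invr R)).
  exact: measurable_marginal.
have mc : measurable_fun setT c.
  apply: measurable_funM; first exact: measurable_marginal.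
  apply: measurable_funM; first exact: measurable_marginal.
  apply: (measurableT_comp (@measurable_invr R)); exact: measurable_marginal.
(* The two resampled parts enter through separate factors, so the double inner integral is [c x]
   times the square of [J x]. *)
transitivity (\int[leb #|u|]_x ((c x)%:E * (J x * J x))).
  apply: eq_integral => x _; rewrite /J -integral_weight_cond_density.
  set A := fun y => (w (merge x y) * cond_density g x y)%R.
  have mA : measurable_fun setT (EFin \o A).
    apply/measurable_EFinP; apply: measurable_funM.
      exact: (measurableT_comp mw (measurable_merge1 x)).
    exact: (measurableT_comp measurable_cond_density (measurable_pair1 x)).
  have A0 y : (0 <= A y)%R by rewrite mulr_ge0.
  transitivity (\int[leb #|~: u|]_y1 ((c x)%:E * (A y1)%:E *
      \int[leb #|~: u|]_y2 (A y2)%:E)).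
    apply: eq_integral => y1 _; rewrite -ge0_integralZl//; last 2 first.
    - by move=> y _; rewrite lee_fin.
    - by rewrite mule_ge0 ?lee_fin.
    apply: eq_integral => y2 _; rewrite /= -!EFinM; congr EFin.
    rewrite /F /A /c /=; ring.
  rewrite ge0_integralZr//; last 3 first.
  - by apply: emeasurable_funM.
  - by move=> y _; rewrite mule_ge0 ?lee_fin.
  - by apply: integral_ge0 => y _; rewrite lee_fin.
  rewrite ge0_integralZl//; last 2 first.
  - by move=> y _; rewrite lee_fin.
  - by rewrite lee_fin.
  by rewrite muleA.
apply: ge0_ae_eq_integral => //.
- apply: emeasurable_funM; first exact/measurable_EFinP.
  exact: emeasurable_funM.
- by apply/measurable_EFinP; exact: measurable_moment2.
- by move=> x _; rewrite mule_ge0 ?lee_fin// mule_ge0.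
- by move=> x _; rewrite lee_fin.
apply: filterS2 f_ae g_ae => x fx gx _.
rewrite /J emarginal_bfE// -!EFinM /c; congr EFin.
have [gx0|gx0] := eqVneq (marginal g x) 0%R.
  by rewrite marginal_eq0// gx0 !(mul0r, mulr0, expr0n).
(* The inverse of [marginal f x], possibly that of 0, is made opaque so that [field] only requires
   [marginal g x] to be nonzero. *)
by set i := (marginal f x)^-1%R; field.
Qed.

End pick_freeze.

End importance_weights.

(** * The indicator [psi] and the unbiasedness theorem *)

Section target_function.
Context {R : realType} {d : nat}.
Variables (D : 'I_d -> set R) (phi : d.-tuple R -> R) (t : R).

Lemma psi_ge0 x : 0 <= psi D t phi x.
Proof. by rewrite /psi indicE. Qed.

Lemma psi_le1 x : psi D t phi x <= 1.
Proof. by rewrite /psi indicE lern1 leq_b1. Qed.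

Hypotheses (mD : forall i, measurable (D i)).
Hypothesis mphi : measurable_fun (domain D) phi.

(** [phi] is measurable only on the domain, so its level set is taken inside the domain, which is a
    measurable box. *)
Lemma measurable_psi : measurable_fun setT (psi D t phi).
Proof.
apply: measurable_indic.
have mdom : measurable (domain D) by exact: measurable_box.
rewrite (_ : [set z | _] = domain D `&` phi @^-1` `]t, +oo[%classic).
  exact: mphi.
by apply/seteqP; split => z /=; rewrite in_itv/= andbT.
Qed.

End target_function.


Theorem proposition2
  (R : realType) (d : nat)
  (D : 'I_d -> set R) (mD : forall i, measurable (D i))
  (phi : d.-tuple R -> R) (mphi : measurable_fun (domain D) phi) (t : R)
  (f : d.-tuple R -> R) (hf : is_density D f)
  (d0 : measure_display) (O0 : measurableType d0) (P0 : probability O0 R)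
  (X0 : {RV P0 >-> d.-tuple R}) (hX0 : has_density X0 f)
  (u : {set 'I_d}) (u_neq0 : u <> finset.set0) (u_neqT : u <> finset.setT)
  (g : d.-tuple R -> R) (hg : is_density D g)
  (hfg : forall x, domain D x -> 0 < psi D t phi x * f x -> 0 < g x)
  (N Nu : nat) (hN : (2 <= N)%N) (hNu : (1 <= Nu)%N)
  (dO : measure_display) (O : measurableType dO) (P : probability O R)
  (X : 'I_N -> {RV P >-> d.-tuple R}) (hX : iid_with_density X g)
  (Xu : 'I_Nu -> {RV P >-> #|u|.-tuple R})
  (hXu : iid_with_density Xu (marginal g))
  (Y1 Y2 : 'I_Nu -> {RV P >-> #|~: u|.-tuple R})
  (hY1 : forall n, has_cond_density P (Xu n) (Y1 n) (cond_density g))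
  (hY2 : forall n, has_cond_density P (Xu n) (Y2 n) (cond_density g))
  (hY12 : forall n, cond_independent P (Xu n) (Y1 n) (Y2 n)) :
  ('E_P[fun w => TVE_PF_IS D f g t phi (Xu ^~ w) (Y1 ^~ w) (Y2 ^~ w) (X ^~ w)]
   = TVE D t phi u P0 X0)%E
  /\
  forall w : O,
    let estimator_prog :=
      TVE_PF_IS_prog D f g t (Xu ^~ w) (Y1 ^~ w) (Y2 ^~ w) (X ^~ w) in
    let p_prog := p_IS_ub_prog D f g t (X ^~ w) in
    [/\ run phi estimator_prog =
          TVE_PF_IS D f g t phi (Xu ^~ w) (Y1 ^~ w) (Y2 ^~ w) (X ^~ w),
        run phi p_prog = p_IS_ub D f g t phi (X ^~ w) &
        nb_evals phi estimator_prog = (2 * Nu + nb_evals phi p_prog)%N].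
Proof.
split; last first.
  move=> w /=; split.
  - exact: run_TVE_PF_IS_prog.
  - exact: run_p_IS_ub_prog.
  - exact: nb_evals_TVE_PF_IS_prog.
have [mf f0 _ f1] := hf; have [mg g0 _ g1] := hg.
have mb := measurable_psi t mD mphi.
have b0 := psi_ge0 D phi t; have b1 := psi_le1 D phi t.
set b := psi D t phi in mb b0 b1.
(* Off the support of [b] the product is 0; on it, a positive product would force [g x > 0] by
   [hfg]. *)
have bfg x : g x = 0 -> b x * f x = 0.
  move=> gx0; have [xD|xD] := boolP (x \in [set z | domain D z /\ t < phi z]).
    have [Dx _] := set_mem xD; apply/eqP; rewrite eq_le mulr_ge0// andbT leNgt.
    by apply/negP => /(hfg _ Dx); rewrite gx0 ltxx.
  by rewrite /b /psi indicE (negbTE xD) mul0r.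
pose v := fine (regression_moment2 u f b).
have vE : regression_moment2 u f b = v%:E.
  by rewrite fineK//; exact: (regression_moment2_fin_num u mf f0 f1 mb b0 b1 hX0).
(* [p] is the exceedance probability p_t; the integral is finite because [b * f] is at most [f]. *)
pose p := fine (\int[lebesgue_tuple d]_x (b x * f x)%:E)%E.
have pE : (\int[lebesgue_tuple d]_x (b x * f x)%:E)%E = p%:E.
  rewrite fineK// ge0_fin_numE; last first.
    by apply: integral_ge0 => x _; rewrite lee_fin mulr_ge0.
  rewrite (le_lt_trans _ (ltry 1))// -f1; apply: ge0_le_integral => //.
  - by move=> x _; rewrite lee_fin mulr_ge0.
  - by apply/measurable_EFinP; exact: measurable_funM.
  - exact/measurable_EFinP.
  - by move=> x _; rewrite lee_fin ler_piMl.
(* The chosen [cond_exp] is exchanged for [regression]; its variance is the second moment [v] minus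
   the square of its mean [p]. *)
have -> : TVE D t phi u P0 X0 = (v - p ^+ 2)%:E.
  have mX0 : measurable_fun setT (subvec u \o X0).
    exact: (measurableT_comp measurable_subvec).
  have regE := is_cond_exp_regression u mf f0 f1 mb b0 b1 hX0.
  have [condE cond_ae] := cond_exp_ae_eq mX0 regE.
  have mreg := measurable_is_cond_exp regE.
  rewrite /TVE (variance_ae_eq (measurable_is_cond_exp condE) mreg cond_ae).
  apply: has_mean_variance; apply: ge0_has_mean => //.
  - by move=> w; exact: regression_ge0.
  (* The mean is the defining identity of the conditional expectation over the whole space, the
     preimage of [setT]. *)
  - have [_ _ ->] := regE; first by rewrite -pE -(integral_target mf f0 mb b0 hX0).
    by exists setT => //; rewrite preimage_setT setTI.
  - exact: (measurable_funX 2 mreg).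
  - by move=> w; rewrite sqr_ge0.
  - by rewrite -vE -(integral_regression_sqr u mf f0 f1 mb b0 b1 hX0).
have mw : measurable_fun setT (weight D f g t phi).
  apply: measurable_funM; first exact: measurable_funM.
  exact: (measurableT_comp (@measurable_invr R)).
have w0 x : 0 <= weight D f g t phi x by rewrite divr_ge0 ?mulr_ge0 ?b0.
have [indX Xg] := hX; have [_ Xug] := hXu.
pose T n w := weight D f g t phi (merge (Xu n w) (Y1 n w)) *
  weight D f g t phi (merge (Xu n w) (Y2 n w)) *
  (marginal g (Xu n w) / marginal f (Xu n w)).
have Tv n : has_mean P (T n) v.
  apply: ge0_has_mean.
  - have mmerge (Y : {RV P >-> #|~: u|.-tuple R}) : measurable_fun setT
        (fun w => weight D f g t phi (merge (Xu n w) (Y w))).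
      apply: (measurableT_comp mw); apply: (measurableT_comp measurable_merge
        (g := fun w => (Xu n w, Y w))).
      exact/measurable_fun_pair.
    apply: measurable_funM; first exact: measurable_funM.
    apply: (measurable_funM (f := fun w => marginal g (Xu n w))
      (g := fun w => (marginal f (Xu n w))^-1)).
      apply: (measurableT_comp (f := marginal g)) => //; exact: measurable_marginal.
    apply: (measurableT_comp (@measurable_invr R)).
    by apply: (measurableT_comp (f := marginal f)) => //; exact: measurable_marginal.
  - move=> w; rewrite /T mulr_ge0 ?mulr_ge0 ?w0 ?invr_ge0//; exact: marginal_ge0.
  - by rewrite -vE; exact: (integral_weight_pair mf f0 f1 mg g0 g1 mb b0 b1 bfg).
pose W (i : 'I_N) w := weight D f g t phi (X i w).
(* For distinct samples, independence and nonnegativity give both the integrability of the product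
   and its mean from the first moments alone. *)
have WW i j : j != i -> has_mean P (fun w => W i w * W j w) (p * p).
  rewrite eq_sym => ij; have mW k : measurable_fun setT (W k).
    exact: (measurableT_comp mw).
  have intW k : (\int[P]_w (W k w)%:E = p%:E)%E.
    by rewrite -pE; exact: (integral_weight mf f0 mg g0 mb b0 bfg (Xg k)).
  apply: ge0_has_mean; [exact: measurable_funM|by move=> w; rewrite mulr_ge0 ?w0|].
  under eq_integral do rewrite EFinM.
  rewrite EFinM -{1}(intW i) -(intW j).
  apply: (integral_independent_mul (a := EFin \o weight D f g t phi)
    (b := EFin \o weight D f g t phi)).
  - by move=> A B mA mB; exact: mutually_independent_pair.
  - exact/measurable_EFinP.
  - exact/measurable_EFinP.
  - by move=> x; rewrite lee_fin w0.
  - by move=> x; rewrite lee_fin w0.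
have N0 : N%:R != 0 :> R by rewrite pnatr_eq0; case: N hN {X hX Xg indX W WW}.
have N1 : N%:R - 1 != 0 :> R.
  by rewrite subr_eq0 -[1]/(1%:R) eqr_nat; case: N hN {X hX Xg indX W WW N0} => [|[]].
have Nu0 : Nu%:R != 0 :> R by rewrite pnatr_eq0 -lt0n.
(* By linearity, the average of the [T n] minus the off-diagonal average of the [W i * W j] has mean
   [v - p ^+ 2]; [sqr_mean_sub_var] then recognizes the estimator. *)
have := has_meanB
  (has_meanZ Nu%:R^-1 (has_mean_sum (index_enum 'I_Nu) (fun n (_ : true) => Tv n)))
  (has_meanZ (N%:R * (N%:R - 1))^-1 (has_mean_sum (index_enum 'I_N)
    (fun i (_ : true) => has_mean_sum (index_enum 'I_N) (WW i)))).
set S := (X in has_mean P X _); set m := (X in has_mean P _ X) => -[_ Sm].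
rewrite (_ : (fun w => _) = S); last first.
  apply/funext => w; rewrite /S /TVE_PF_IS /p_IS_ub /p_IS sqr_mean_sub_var//.
rewrite Sm; congr EFin; rewrite /m sumr_const card_ord.
(* Each [i] has [N.-1] partners [j], and [1 <= N] allows the passage from natural to real
   subtraction. *)
under eq_bigr => i _ do rewrite sumr_const cardC1 card_ord.
rewrite sumr_const card_ord -mulrnA -[v *+ _]mulr_natl -[p * p *+ _]mulr_natl natrM.
rewrite -subn1 natrB ?(ltnW hN)//; by field; rewrite N0 N1 Nu0.
Qed.
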